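(* Consider the multi-agent ski-rental problem. Under any given state $\{N_n\}_{n\le\ell}$, for each of the three types of competitive ratio (overall $\mathrm{CR}^{(\mathrm{OV})}$, state-dependent $\mathrm{CR}^{(\mathrm{SD})}$, and individual rational $\mathrm{CR}^{(\mathrm{IND})}_m$), the competitive ratio over all randomized policies is minimized by a symmetric randomized policy.
   Context: Multi-agent ski-rental problem: $M,B,G$ are known positive integers with $B<G<MB$. There are agents $m\in\{1,\dots,M\}$. An instance is $\mathcal I=\{N_1,\dots,N_M\}$ with positive integers $N_1\le\dots\le N_M$, where $N_m$ is the number of active days of agent $m$; these are unknown in advance to an online policy, and $N_m$ is revealed at the end of day $N_m$, when agent $m$ becomes inactive. On each day $t\le N_m$, agent $m$, if it has not yet bought a pass, takes one of the actions: Rent (cost $1$), Ind (buy an individual pass, cost $B$, covering all its remaining active days), or Group (join the purchase of a group pass, cost $G/k$, where $k$ is the number of agents taking the action Group on that day, covering all its remaining active days). An agent that is inactive or has already bought a pass takes the action Null (cost $0$). A deterministic policy $\pi$ maps the history of the decision process to one action for each agent. $\mathrm{Cost}_m(\pi,\mathcal I)$ is the total cost of agent $m$ over days $1,\dots,N_m$, and $\mathrm{Cost}(\pi,\mathcal I)=\sum_{m=1}^M\mathrm{Cost}_m(\pi,\mathcal I)$. A randomized policy $f$ is a probability distribution over deterministic policies (possibly realized by sampling at specific points of the process), and its costs are the expectations over $\pi\sim f$ of $\mathrm{Cost}(\pi,\mathcal I)$ and $\mathrm{Cost}_m(\pi,\mathcal I)$, denoted $\mathrm{Cost}(f,\mathcal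 I)$ and $\mathrm{Cost}_m(f,\mathcal I)$. State: when $\ell$ agents have become inactive (because their active days have passed, without buying), the state is the list $\{N_n\}_{n\le\ell}$ of their revealed numbers of active days (abbreviated $\ell$; empty list if $\ell=0$), $0\le\ell\le M-1$. $\mathfrak I\mid\{N_n\}_{n\le\ell}$ denotes the set of instances whose first $\ell$ agents have active days $\{N_n\}_{n\le\ell}$. Symmetric: under a given state, each active agent follows a threshold (it rents on days before the threshold and buys a pass on the threshold day if still active). A randomized policy is symmetric if it is supported on policies in which all active agents use the same (commonly sampled) threshold; it may resample the common threshold when the state changes. Benchmarks: $\mathrm{OPT}^{(\mathrm{OV})}(\mathcal I)=\min\{G,\sum_{m=1}^M\min\{B,N_m\}\}$; $\mathrm{OPT}^{(\mathrm{SD})}(\mathcal I\mid\{N_n\}_{n\le\ell})=\sum_{n=1}^{\ell}N_n+\min\{G,\sum_{n=\ell+1}^M\min\{N_n,B\}\}$; and, with $\ell_*=\min\{0\le j\le M-1: N_{j+1}>\min\{G/(M-j),B\}\}$ ($\ell_*=M$ if there is no such $j$, with $G/0=+\infty$), $\mathrm{OPT}^{(\mathrm{IND})}_m(\mathcal I)=N_m$ if $N_m\le\min\{G/(M-\ell_* ),B\}$ and $\min\{G/(M-\ell_* ),B\}$ otherwise. Competitive ratios (maxima over $\mathcal I\in\mathfrak I\mid\{N_n\}_{n\le\ell}$): $\mathrm{CR}^{(\mathrm{OV})}(f\mid\{N_n\}_{n\le\ell})=\max\mathrm{Cost}(f,\mathcal I)/\mathrm{OPT}^{(\mathrm{OV})}(\mathcal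 I)$; $\mathrm{CR}^{(\mathrm{SD})}(f\mid\{N_n\}_{n\le\ell})=\max\mathrm{Cost}(f,\mathcal I)/\mathrm{OPT}^{(\mathrm{SD})}(\mathcal I\mid\{N_n\}_{n\le\ell})$; $\mathrm{CR}^{(\mathrm{IND})}_m(f\mid\{N_n\}_{n\le\ell})=\max\mathrm{Cost}_m(f,\mathcal I)/\mathrm{OPT}^{(\mathrm{IND})}_m(\mathcal I)$.
   Formalization: ''Under a given state'' is read as: only randomized policies under which, almost surely, no agent has bought a pass by the end of day N_ℓ are compared. Over literally all policies it fails: M=3, B=4, G=11, state (1,3), buying Ind for agent 3 on day 1 gives overall ratio 8/7, symmetric at least 11/8. *)

(* Defs.v *)
From HB Require Import structures.
From mathcomp Require Import all_boot all_order all_algebra.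
From mathcomp Require Import all_classical all_reals all_analysis.

Set Implicit Arguments.
Unset Strict Implicit.
Unset Printing Implicit Defensive.

Import Order.TTheory GRing.Theory Num.Theory.

Local Open Scope classical_set_scope.
Local Open Scope ring_scope.

(** Agents are the elements of ['I_M], numbered from 0: agent [m : 'I_M] is
    agent m + 1 of the usual numbering.  Day [t.+1] is preceded by [t] days. *)

Inductive move := Rent | Ind | Group.

Definition move_code (a : move) : option bool :=
  match a with Rent => None | Ind => Some true | Group => Some false end.
Definition move_decode (c : option bool) : move :=
  match c with None => Rent | Some true => Ind | Some false => Group end.
Lemma move_codeK : cancel move_code move_decode. Proof. by case. Qed.

HB.instance Definition _ := Countable.copy move (can_type move_codeK).
HB.instance Definition _ := isPointed.Build move Rent.

(** [None] is the action Null. *)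
Definition action := option move.

(** One record per past day: the joint action of that day, and the set of the
    agents that became inactive at its end. *)
Definition day_record (M : nat) : Type := {ffun 'I_M -> action} * {set 'I_M}.
Definition history (M : nat) := seq (day_record M).

(** [pi h m] is only executed when agent [m] is active and has no pass at
    the end of [h]; otherwise [m] takes Null (see [joint_action]). *)
Definition policy (M : nat) := history M -> 'I_M -> move.

Definition is_buy (a : action) : bool := (a == Some Ind) || (a == Some Group).

Definition bought (M : nat) (h : history M) (m : 'I_M) : bool :=
  has (fun r : day_record M => is_buy (r.1 m)) h.

Definition inactive (M : nat) (h : history M) (m : 'I_M) : bool :=
  has (fun r : day_record M => m \in r.2) h.

Definition eligible (M : nat) (h : history M) (m : 'I_M) : bool :=
  ~~ inactive h m && ~~ bought h m.

Definition joint_action (M : nat) (pi : policy M) (h : history M) :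
    {ffun 'I_M -> action} :=
  [ffun m => if eligible h m then Some (pi h m) else None].

(** History of the first [t] days under [pi] on the instance [N]. *)
Fixpoint run (M : nat) (pi : policy M) (N : 'I_M -> nat) (t : nat) :
    history M :=
  if t is t'.+1 then
    let h := run pi N t' in
    rcons h (joint_action pi h, [set m | N m == t]%SET)
  else [::].

Definition instance (M : nat) (N : 'I_M -> nat) : Prop :=
  (forall m, 0 < N m)%N /\ (forall m n : 'I_M, m <= n -> N m <= N n)%N.

(** A state is the list of the revealed numbers of active days; it is entered
    at the end of day [last 0 s] (day 0 for the empty list). *)
Definition is_state (M : nat) (s : seq nat) : Prop :=
  [/\ (size s < M)%N, all (fun n => 0 < n)%N s & sorted leq s].

Definition instances_given (M : nat) (s : seq nat) : set ('I_M -> nat) :=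
  [set N | instance N /\ forall m : 'I_M, (m < size s)%N -> N m = nth 0%N s m].

(** [pi] is compatible with the state [s]: on every instance extending [s] no
    agent has bought a pass when [s] is entered. *)
Definition reaches (M : nat) (s : seq nat) (pi : policy M) : Prop :=
  forall N, instances_given s N ->
  forall m, ~~ bought (run pi N (last 0%N s)) m.

(** State before day [t.+1] of the instance [N]. *)
Definition state_before (M : nat) (N : 'I_M -> nat) (t : nat) : seq nat :=
  [seq N m | m <- enum 'I_M & (N m <= t)%N].

(** [T s] is the common threshold used under the state [s], and [K s] says
    which pass all the active agents buy.  If [T s] does not exceed the last
    day before [s] is entered, the purchase is on the first day of [s]. *)
Definition symmetric (M : nat) (pi : policy M) : Prop :=
  exists (T : seq nat -> nat) (K : seq nat -> move),
    (forall s, K s <> Rent) /\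
    forall N, instance N ->
    forall (t : nat) (m : 'I_M), eligible (run pi N t) m ->
      pi (run pi N t) m =
        if (t.+1 < T (state_before N t))%N then Rent else K (state_before N t).

(** Randomized policies: probability measures on the product sigma-algebra. *)
Definition cylinders (M : nat) : set (set (policy M)) :=
  [set A | exists (h : history M) (m : 'I_M) (a : move),
     A = [set pi | pi h m = a]].

Definition randomized_policy (R : realType) (M : nat) :=
  probability (g_sigma_algebraType (@cylinders M)) R.

Section Costs.
Variables (R : realType) (M B G : nat).
Implicit Types (pi : policy M) (f : randomized_policy R M) (N : 'I_M -> nat).

Definition price (a : {ffun 'I_M -> action}) (m : 'I_M) : R :=
  match a m with
  | None => 0
  | Some Rent => 1
  | Some Ind => B%:R
  | Some Group => G%:R / #|[set k | a k == Some Group]%SET|%:R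
  end.

Definition agent_cost (m : 'I_M) pi N : R :=
  \sum_(t < N m) price (joint_action pi (run pi N t)) m.

Definition total_cost pi N : R := \sum_(m < M) agent_cost m pi N.

Definition OPT_OV N : R := (minn G (\sum_(m < M) minn B (N m)))%:R.

Definition OPT_SD (s : seq nat) N : R :=
  (\sum_(n < M | n < size s) N n +
   minn G (\sum_(n < M | size s <= n) minn (N n) B))%N%:R.

(** min {G / (M - j), B}, with the convention G / 0 = +oo. *)
Definition share (j : nat) : R :=
  if (j < M)%N then Num.min (G%:R / (M - j)%:R) B%:R else B%:R.

Definition ell_star N : nat :=
  \big[minn/M]_(j < M | share j < (N j)%:R) (j : nat).

Definition OPT_IND (m : 'I_M) N : R :=
  if (N m)%:R <= share (ell_star N) then (N m)%:R else share (ell_star N).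

Definition expected_cost (cost : policy M -> ('I_M -> nat) -> R) f N :
    \bar R :=
  (\int[f]_pi (cost pi N)%:E)%E.

(** The maximum ranges over infinitely many instances: it is a supremum, which
    is +oo when unbounded. *)
Definition CR (cost : policy M -> ('I_M -> nat) -> R) (opt : ('I_M -> nat) -> R)
    (s : seq nat) f : \bar R :=
  ereal_sup [set (expected_cost cost f N * ((opt N)^-1)%:E)%E
            | N in instances_given s].

Definition CR_OV (s : seq nat) := CR total_cost OPT_OV s.
Definition CR_SD (s : seq nat) := CR total_cost (OPT_SD s) s.
Definition CR_IND (m : 'I_M) (s : seq nat) := CR (agent_cost m) (OPT_IND m) s.

End Costs.

Definition minimized_by_symmetric (R : realType) (M : nat) (s : seq nat)
    (cr : randomized_policy R M -> \bar R) : Prop :=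
  exists f : randomized_policy R M,
    [/\ {ae f, forall pi, reaches s pi},
        {ae f, forall pi, symmetric pi} &
        forall g : randomized_policy R M,
          {ae g, forall pi, reaches s pi} -> (cr f <= cr g)%E].

(* Main.v *)
Require Import Defs.
From HB Require Import structures.
From mathcomp Require Import all_boot all_order all_algebra.
From mathcomp Require Import all_classical all_reals all_analysis.
From mathcomp Require Import measurable_realfun.
From mathcomp Require Import ring lra zify.

(** A symmetric randomized policy amounts to the probability [Phi N d] that the
    active agents have bought by day [d] of the instance [N]: a uniform sample [u]
    is drawn once and everybody buys on the first day with [u <= Phi N d].  It is
    enough to turn each randomized policy [g] whose costs are at most [c] times the
    benchmark into such a [Phi] with the same guarantee: a pointwise limit of laws
    [Phi], along an ultrafilter on [nat], for constants [c] tending to the infimum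
    then realizes the infimum.

    For the individual ratio of agent [m], [Phi] is the probability under [g] that
    agent [m] has bought; joining him only lowers his price.

    For the overall ratios, on days with [k] active agents and [G <= k B], [Phi] is
    the expected fraction [min (1, x / G)], where [x] is the total amount spent on
    passes under [g].  If fewer agents are active when the state is entered, it is the
    average fraction of the agents that have bought under [g] on the instance in
    which they all stay active, and the concavity of the benchmark reduces all
    other instances to this one.  If the number of active agents falls below [G / B]
    later, on day [tau], [Phi] grows geometrically at rate [1 / (1 - 1 / B)], so that
    the cost increases exactly [c] times as fast as the benchmark.  It reaches 1
    in time because [g] also had to be safe on the instance in which [G / B],
    rounded up, agents stay active after day [tau], which is harder. *)

Set Implicit Arguments.
Unset Strict Implicit.
Unset Printing Implicit Defensive.

Import Order.TTheory GRing.Theory Num.Theory.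
Import numFieldNormedType.Exports.

Local Open Scope ring_scope.

(** * The exhaustion of a group budget *)

(** After day [tau] the policy [g] cannot be copied: [Phi] measures money spent, and this money may
    have bought passes for agents that have left since, so it does not determine the fraction of the
    remaining agents that hold a pass. Only the guarantee of [g] is kept, condensed into one number.
    Suppose that [k] agents rent and that passes for all of them cost [P]. With [H = Phi + c - 1],
    the cost grows by exactly [c * k] per day iff [H] is divided by [1 - k / P] every day, and the
    purchase is complete when [H = c]. Unspent slack of the guarantee counts as additional
    probability, bought at price [G]. This gives the potential: [budget_needed] bounds it below for
    [k] agents and [P = G], [catch_up] starts from it with [a = k - 1] agents and [P = a * B], and
    the inequalities on [decay] compare the two products.

    In the limit of laws, purchases could escape to infinitely late days. They do not, because the
    benchmarks are bounded while the cost of renting is not; this is what turns the limit into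
    actual thresholds. *)

Section Decay.
Variable R : realFieldType.
Implicit Types (k J r B P G : nat).

(* The factor lost by the potential of [budget_needed] when [r] units of budget
   are rented at [k] units per day and the full pass costs [P]. *)
Definition decay k P r : R :=
  (1 - k%:R / P%:R) ^+ (r %/ k) * (1 - (r %% k)%:R / P%:R).

Lemma rate_bounds k P : (0 < P)%N -> (k <= P)%N -> 0 <= (1 - k%:R / P%:R : R) <= 1.
Proof.
move=> P0 kP; have P0' : 0 < P%:R :> R by rewrite ltr0n.
by rewrite subr_ge0 ler_pdivrMr // mul1r ler_nat kP /= gerBl divr_ge0.
Qed.

(** The boundary [r = k] is allowed, as a full last step gives the same factor as one more power.
    This spares a case distinction wherever a remainder is only known up to equality. *)
Lemma decayE k P J r : (0 < k)%N -> (r <= k)%N ->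
  decay k P (k * J + r) = (1 - k%:R / P%:R) ^+ J * (1 - r%:R / P%:R).
Proof.
move=> k0; rewrite leq_eqVlt => /orP[/eqP ->|rk]; rewrite /decay.
  have -> : (k * J + k = J.+1 * k)%N by rewrite mulSn addnC mulnC.
  by rewrite mulnK // modnMl mul0r subr0 mulr1 exprSr.
by rewrite mulnC divnMDl // divn_small // addn0 modnMDl modn_small.
Qed.

Lemma decay_ge0 k P r : (0 < k <= P)%N -> 0 <= decay k P r.
Proof.
case/andP=> k0 kP; have P0 := leq_trans k0 kP.
apply: mulr_ge0.
  by apply: exprn_ge0; case/andP: (rate_bounds P0 kP).
by case/andP: (rate_bounds P0 (leq_trans (ltnW (ltn_pmod r k0)) kP)).
Qed.

Lemma decayS k P r : (0 < k <= P)%N ->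
  decay k P r.+1 <= (1 - 1 / P%:R) * decay k P r.
Proof.
move=> /[dup] kP /andP[k0 kP']; have P0 := leq_trans k0 kP'.
have rk : (r %% k < k)%N by rewrite ltn_pmod.
have -> : r.+1 = (k * (r %/ k) + (r %% k).+1)%N by rewrite addnS mulnC -divn_eq.
rewrite decayE // /decay mulrCA ler_wpM2l //.
  by apply: exprn_ge0; case/andP: (rate_bounds P0 kP').
(* This product is the difference of the two sides once the common power is removed. *)
have : 0 <= 1 / P%:R * ((r %% k)%:R / P%:R) :> R by rewrite mulr_ge0 ?divr_ge0.
by rewrite -natr1 mulrDl => ?; nra.
Qed.

Lemma decay_le_iter k P r m : (0 < k <= P)%N ->
  decay k P (r + m) <= (1 - 1 / P%:R) ^+ m * decay k P r.
Proof.
move=> kP; elim: m => [|m IH]; first by rewrite addn0 expr0 mul1r.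
rewrite addnS exprS -mulrA; apply: (le_trans (decayS _ kP)).
have /andP[k0 kP'] := kP.
rewrite ler_wpM2l //.
by case/andP: (@rate_bounds 1 P (leq_trans k0 kP') (leq_trans k0 kP')).
Qed.

Lemma decay_homo k P r r' : (0 < k <= P)%N -> (r <= r')%N ->
  decay k P r' <= decay k P r.
Proof.
move=> kP rr'; rewrite -(subnKC rr'); apply: (le_trans (decay_le_iter _ _ kP)).
have /andP[k0 kP'] := kP.
rewrite ler_piMl ?decay_ge0 //.
have /andP[? ?] := @rate_bounds 1 P (leq_trans k0 kP') (leq_trans k0 kP').
exact: exprn_ile1.
Qed.

(* In unit steps, [decay a (G - 1)] multiplies cyclically by [1 - 1 / p] for [p]
   from [G - 1] down to [G - a], and [decay (a + 1) G] by the same factors with an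
   additional [1 - 1 / G] at the beginning of each cycle. *)
Lemma decay_pred_price a G r : (0 < a)%N -> (a.+1 < G)%N ->
  decay a G.-1 r <= decay a.+1 G r.
Proof.
move=> a0 aG; set k := a.+1.
have G1 : (0 < G.-1)%N by lia.
have aG' : (0 < a <= G.-1)%N by lia.
have rk : (r %% k < k)%N by rewrite ltn_pmod.
have Er := divn_eq r k; move: (r %/ k)%N (r %% k)%N Er rk => J z -> {r} zk.
have G0' : G%:R != 0 :> R by rewrite pnatr_eq0; lia.
have G1' : G.-1%:R != 0 :> R by rewrite pnatr_eq0; lia.
have EG : G%:R = G.-1%:R + 1 :> R by rewrite natr1 prednK //; lia.
have Ek : k%:R = a%:R + 1 :> R by rewrite natr1.
have w0 : 0 <= 1 - 1 / G.-1%:R :> R.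
  by case/andP: (@rate_bounds 1 G.-1 G1 G1).
have w1 : 1 - 1 / G.-1%:R <= G.-1%:R / G%:R :> R.
  have -> : G.-1%:R / G%:R = 1 - 1 / G%:R :> R by rewrite EG; field; rewrite -EG.
  rewrite lerD2l lerN2 ler_pM2l // lef_pV2 ?posrE ?ltr0n // ?ler_nat; lia.
have fac : (1 - k%:R / G%:R) = (1 - a%:R / G.-1%:R) * (G.-1%:R / G%:R) :> R.
  by rewrite Ek EG; field; rewrite -EG G1' G0'.
rewrite [X in _ <= decay _ _ X]addnC [X in decay k _ X]addnC mulnC decayE //; last exact: ltnW.
rewrite fac exprMn.
(* The units are split into [t], whose decay at price [G - 1] is computed exactly, and [m], each
   bounded by the factor [(G - 1) / G]. Since [k = a + 1], every cycle leaves one unit for [m]. *)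
have step m t : (k * J + z = t + m)%N ->
    (G.-1%:R / G%:R) ^+ m * decay a G.-1 t
      <= (1 - a%:R / G.-1%:R) ^+ J * (G.-1%:R / G%:R) ^+ J * (1 - z%:R / G%:R) ->
    decay a G.-1 (k * J + z) <= (1 - a%:R / G.-1%:R) ^+ J *
      (G.-1%:R / G%:R) ^+ J * (1 - z%:R / G%:R).
  move=> -> h; apply: le_trans h; apply: (le_trans (decay_le_iter _ _ aG')).
  rewrite ler_wpM2r ?decay_ge0 // lerXn2r // nnegrE ?divr_ge0 //.
case: z zk step => [|z] zk step.
  apply: (step J (a * J + 0)%N); first by rewrite /k; lia.
  by rewrite decayE // !mul0r subr0 !mulr1 mulrC.
apply: (step J.+1 (a * J + z)%N); first by rewrite /k; lia.
rewrite decayE //; last by lia.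
rewrite le_eqVlt exprSr; apply/orP; left; apply/eqP.
have -> : 1 - z.+1%:R / G%:R = G.-1%:R / G%:R * (1 - z%:R / G.-1%:R) :> R.
  by rewrite -natr1 EG; field; rewrite -EG G0' G1'.
by ring.
Qed.

Lemma decay_le_price k P P' r : (0 < k <= P)%N -> (P <= P')%N ->
  decay k P r <= decay k P' r.
Proof.
case/andP=> k0 kP PP'.
have P0 := leq_trans k0 kP; have kP' := leq_trans kP PP'.
have rk : (r %% k < k)%N by rewrite ltn_pmod.
have mon z : (1 - z%:R / P%:R) <= (1 - z%:R / P'%:R) :> R.
  by rewrite lerD2l lerN2 ler_wpM2l // lef_pV2 ?posrE ?ltr0n ?ler_nat //; lia.
rewrite /decay ler_pM //.
- by apply: exprn_ge0; case/andP: (rate_bounds P0 kP).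
- have rP : (r %% k <= P)%N by lia.
  by case/andP: (rate_bounds P0 rP).
- rewrite lerXn2r ?nnegrE //; first by case/andP: (rate_bounds P0 kP).
  by case/andP: (rate_bounds (leq_trans P0 PP') kP').
Qed.

Lemma Bernoulli_ge (x : R) n : 0 <= x <= 1 -> 1 - n%:R * x <= (1 - x) ^+ n.
Proof.
case/andP=> x0 x1; elim: n => [|n IH]; first by rewrite mul0r subr0 expr0.
rewrite exprS; apply: (@le_trans _ _ ((1 - x) * (1 - n%:R * x))); last first.
  by rewrite ler_wpM2l // subr_ge0.
have : 0 <= n%:R * x * x :> R by rewrite !mulr_ge0.
by rewrite -natr1; nra.
Qed.

(** A larger budget makes the pass dearer but leaves one more unit to rent, and the second effect
    wins. Each full factor changes by [1 - x]; by Bernoulli's inequality all of them together lose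
    at most the factor [1 - 1 / (G + 1)], which is exactly what the additional unit costs. The
    assumption [t > 0] keeps the number of full factors small enough. *)
Lemma decay_succ_budget k G t : (0 < k)%N -> (0 < t)%N -> (k * t <= G)%N ->
  decay k G.+1 (G.+1 - k * t) <= decay k G (G - k * t).
Proof.
move=> k0 t0 ktG; have kG : (k <= G)%N by apply: leq_trans ktG; rewrite leq_pmulr.
set r := (G - k * t)%N; have -> : (G.+1 - k * t = r.+1)%N by rewrite /r; lia.
have rk : (r %% k < k)%N by rewrite ltn_pmod.
have Er := divn_eq r k.
have JG : ((r %/ k) * k + k <= G)%N.
  have : (r %/ k * k <= r)%N by rewrite leq_trunc_div.
  by rewrite /r; nia.
move: (r %/ k)%N (r %% k)%N Er rk JG => J z -> {r} zk JG.
rewrite -addnS ![(J * k)%N]mulnC !decayE //; last exact: ltnW.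
have G0 : 0 < G%:R :> R by rewrite ltr0n; lia.
have EG : G.+1%:R = G%:R + 1 :> R by rewrite natr1.
case: J JG => [|J] JG.
  rewrite !expr0 !mul1r lerD2l lerN2 -natr1 EG.
  rewrite ler_pdivrMr // mulrAC ler_pdivlMr; last by rewrite -EG ltr0n.
  have : (z%:R <= G%:R :> R) by rewrite ler_nat; lia.
  by nra.
have kGlt : k%:R < G%:R :> R by rewrite ltr_nat; nia.
pose x : R := k%:R / ((G%:R + 1 - k%:R) * G%:R).
have G0n : G%:R != 0 :> R by rewrite gt_eqF.
have G1n : G%:R + 1 != 0 :> R by rewrite gt_eqF // -EG ltr0n.
have Gkn : G%:R + 1 - k%:R != 0 :> R by rewrite gt_eqF //; lra.
have fac : 1 - k%:R / G%:R = (1 - k%:R / G.+1%:R) * (1 - x) :> R.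
  by rewrite /x EG; field; rewrite G0n G1n Gkn.
have x0 : 0 <= x by rewrite divr_ge0 // mulr_ge0 //; lra.
have kJ : J.+1%:R * k%:R <= G%:R - k%:R :> R.
  by rewrite lerBrDr -natrM -natrD ler_nat.
have Gk0 : 0 < G%:R + 1 - k%:R :> R by lra.
have Jx : J.+1%:R * x <= 1 / (G%:R + 1).
  rewrite /x mulrA ler_pdivrMr ?mulr_gt0 // mulrAC ler_pdivlMr; last by lra.
  have k0' : 0 <= k%:R :> R by [].
  by nra.
have x1 : x <= 1.
  have : x <= J.+1%:R * x by rewrite ler_peMl // ler1n.
  have : 1 / (G%:R + 1) <= 1 :> R by rewrite ler_pdivrMr; lra.
  by lra.
have BX := Bernoulli_ge J.+1 (introT andP (conj x0 x1)).
rewrite fac exprMn -mulrA ler_wpM2l //.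
  by apply: exprn_ge0; case/andP: (@rate_bounds k G.+1 isT (leqW kG)).
have z0 : 0 <= 1 - z%:R / G%:R :> R.
  have zG : (z <= G)%N by lia.
  by case/andP: (rate_bounds (leq_trans k0 kG) zG).
apply: (@le_trans _ _ ((1 - 1 / (G%:R + 1)) * (1 - z%:R / G%:R))); last first.
  by rewrite ler_wpM2r //; lra.
by rewrite -natr1 EG le_eqVlt; apply/orP; left; apply/eqP; field; rewrite G0n G1n.
Qed.

(** The power is the decay for the budget [k * B], where [B - t] full steps remain and
    [k / (k * B) = 1 / B]. The budget is then lowered to [G] one unit at a time. *)
Lemma rate_pow_le_decay k G B t r : (0 < k)%N -> (0 < t)%N ->
  (k * t + r <= G)%N -> (G <= k * B)%N ->
  (1 - 1 / B%:R) ^+ (B - t) <= decay k G r.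
Proof.
move=> k0 t0 rG GB; have kG : (0 < k <= G)%N by nia.
apply: (@le_trans _ _ (decay k G (G - k * t))); last by apply: decay_homo => //; lia.
have -> : (1 - 1 / B%:R) ^+ (B - t) = decay k (k * B) (k * B - k * t).
  rewrite -mulnBr -[X in decay _ _ X]addn0 decayE // mul0r subr0 mulr1 natrM.
  have k0' : k%:R != 0 :> R by rewrite pnatr_eq0; lia.
  have B0' : B%:R != 0 :> R by rewrite pnatr_eq0; nia.
  by congr (_ ^+ _); field; rewrite k0' B0'.
rewrite -(subnKC GB); elim: (k * B - G)%N => [|m IH]; first by rewrite addn0.
apply: le_trans IH; rewrite addnS; apply: decay_succ_budget => //; lia.
Qed.

End Decay.

(** * Catching up with individual passes *)

Section Hedging.
Variable R : realFieldType.
Implicit Types (F : nat -> R).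

Definition stage_cost (rent price : R) F (n : nat) : R :=
  \sum_(i < n) (rent * (1 - F i.+1) + price * (F i.+1 - F i)).

Lemma stage_cost0 (rent price : R) F : stage_cost rent price F 0 = 0.
Proof. by rewrite /stage_cost big_ord0. Qed.

Lemma stage_costS (rent price : R) F n : stage_cost rent price F n.+1 =
  stage_cost rent price F n + (rent * (1 - F n.+1) + price * (F n.+1 - F n)).
Proof. by rewrite /stage_cost big_ord_recr. Qed.

(* With [D j] the slack in the [j]-th hypothesis and [H j := F j + c - 1], the
   potential [E j := D j / G + H j] satisfies [(1 - k / G) E (j + 1) <= E j], and
   covering the remaining probability at price [G] requires it to be large. *)
Lemma budget_needed (k G : nat) (c : R) (n x : nat) (X : R) F :
  (0 < k <= G)%N -> (x + n = G)%N -> 0 <= c ->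
  (forall i, 0 <= F i <= 1) -> (forall i, F i <= F i.+1) ->
  (forall j, X + stage_cost k%:R G%:R F j <= c * (minn G (x + k * j))%:R) ->
  c * decay R k G n <= (c * x%:R - X) / G%:R + F 0%N + c - 1.
Proof.
move=> /andP[k0 kG] + c0.
have G0 : 0 < G%:R :> R by rewrite ltr0n; lia.
elim/ltn_ind: n x X F => n IH x X F xnG F01 Fm hF.
have [nk|kn] := ltnP n k.
  have -> : decay R k G n = 1 - n%:R / G%:R.
    by rewrite /decay divn_small // modn_small // expr0 mul1r.
  have hb j : G%:R * (1 - F 0%N) <= stage_cost G%:R G%:R F j.+1.
    rewrite /stage_cost; under eq_bigr do rewrite -mulrDr; rewrite -mulr_sumr.
    rewrite ler_wpM2l ?(ltW G0) // big_ord_recl /= addrA subrK lerDl.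
    apply: sumr_ge0 => i _; rewrite addr_ge0 // subr_ge0.
      by case/andP: (F01 (bump 0 i).+1).
    exact: Fm.
  (* After [G] days, the rent is at least [G] times the probability still not covered, so waiting
     has cost no less than buying everything at once. *)
  have hG : G%:R * (1 - F 0%N) <= stage_cost k%:R G%:R F G.
    pose L := F G.
    have FL i : (i <= G)%N -> F i <= L.
      by move=> iG; exact: (homo_leq (@lexx _ R) (@le_trans _ R) Fm).
    have : G%:R * (1 - L) + G%:R * (L - F 0%N) <= stage_cost k%:R G%:R F G.
      rewrite /stage_cost big_split /= lerD //.
        have -> : G%:R * (1 - L) = \sum_(i < G) (1 - L).
          by rewrite sumr_const card_ord mulr_natl.
        apply: ler_sum => i _; apply: (@le_trans _ _ (1 * (1 - F i.+1))).
          by rewrite mul1r lerD2l lerN2 FL.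
        by rewrite ler_wpM2r ?ler1n // subr_ge0; case/andP: (F01 i.+1).
      rewrite -mulr_sumr ler_wpM2l ?(ltW G0) //.
      by rewrite -(big_mkord predT (fun i => F i.+1 - F i)) telescope_sumr.
    by rewrite -mulrDr addrA subrK.
  have := hF G; rewrite (minn_idPl _); last by nia.
  move=> h; have {h}hG : X + G%:R * (1 - F 0%N) <= c * G%:R by lra.
  have EG : G%:R = x%:R + n%:R :> R by rewrite -natrD xnG.
  have : X / G%:R + (1 - F 0%N) <= c.
    by rewrite -(ler_pM2r G0) mulrDl divfK ?gt_eqF // mulrC [_ * G%:R]mulrC mulrC; lra.
  have -> : c * (1 - n%:R / G%:R) = c * x%:R / G%:R.
    by rewrite -mulrA; congr (_ * _); rewrite EG; field; rewrite -EG gt_eqF.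
  by rewrite mulrBl; lra.
have xk : (x + k + (n - k) = G)%N by lia.
pose X' := X + (k%:R * (1 - F 1%N) + G%:R * (F 1%N - F 0%N)).
pose E' := (c * (x + k)%:R - X') / G%:R + F 1%N + c - 1.
have hE' : c * decay R k G (n - k) <= E'.
  apply: (IH (n - k)%N _ (x + k)%N X' (fun i => F i.+1)) => //; first by lia.
  move=> j; have := hF j.+1.
  by rewrite /stage_cost big_ord_recl /= addrA mulnS addnA.
have -> : decay R k G n = (1 - k%:R / G%:R) * decay R k G (n - k).
  rewrite /decay -{1 2}(subnK kn) divnDr ?dvdnn // divnn k0 addn1 exprS mulrA.
  by rewrite modnDr.
rewrite mulrCA; apply: (@le_trans _ _ ((1 - k%:R / G%:R) * E')).
  by rewrite ler_wpM2l //; case/andP: (@rate_bounds R k G (leq_trans k0 kG) kG).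
(* Nonnegative slack after one day gives [F 1 + c - 1 <= E']. As [E'] exceeds the potential at time
   0 by [k / G] times the left-hand side, the contraction by [1 - k / G] follows. *)
have h1 : X' <= c * (x + k)%:R.
  have := hF 1%N; rewrite /stage_cost big_ord1 /= muln1 (minn_idPr _) //; lia.
have h2 : F 1%N + c - 1 <= E'.
  have : 0 <= (c * (x + k)%:R - X') / G%:R by rewrite divr_ge0 ?(ltW G0) // subr_ge0.
  by rewrite /E'; lra.
have h3 : E' = (c * x%:R - X) / G%:R + F 0%N + c - 1 + k%:R / G%:R * (F 1%N + c - 1).
  by rewrite /E' /X' natrD; field; rewrite gt_eqF.
have : k%:R / G%:R * (F 1%N + c - 1) <= k%:R / G%:R * E'.
  by rewrite ler_wpM2l // divr_ge0.
by lra.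
Qed.

(* While it is smaller than 1, [catch_up] is chosen so that an agent renting at
   price 1 per day and buying at price [B] pays exactly [c] per day; the value [E]
   already accounts for the slack available at time 0. *)
Definition catch_up (B : nat) (c E F0 : R) (i : nat) : R :=
  if i is 0%N then F0 else
  let q := 1 - 1 / B%:R in
  if c * q ^+ i <= E then 1 else E / q ^+ i - (c - 1).

Section CatchUp.
Variables (a B G x b : nat) (c X F0 : R).
Hypotheses (a0 : (0 < a)%N) (B0 : (0 < B)%N) (aBG : (a * B <= G)%N).
Hypotheses (xG : (x <= G)%N) (c0 : 0 <= c) (F0_01 : 0 <= F0 <= 1).
Let q : R := 1 - 1 / B%:R.
Let D := c * x%:R - X.
Let E := D / G%:R + F0 + c - 1.
Hypothesis D0 : 0 <= D.
(** In terms of [H i = E / q ^+ i], which has to reach [c]: [E_day] says that this happens by day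
    [b]. [E_group] says that when only [o] units of the benchmark remain below [G], completing the
    purchase for [a] agents costs at most [c * o]. *)
Hypothesis E_day : c * q ^+ b <= E.
Hypothesis E_group : forall i o, (o <= a)%N -> (x + a * i + o = G)%N ->
  c * q ^+ i * (1 - o%:R / (a * B)%:R) <= E.
Let F := catch_up B c E F0.

Let q01 : 0 <= q <= 1.
Proof. exact: (@rate_bounds R 1 B B0 B0). Qed.

Let G0 : 0 < G%:R :> R.
Proof. by rewrite ltr0n; apply: leq_trans aBG; rewrite muln_gt0 a0. Qed.

Let B0' : 0 < B%:R :> R. Proof. by rewrite ltr0n. Qed.
Let a0' : 0 < a%:R :> R. Proof. by rewrite ltr0n. Qed.

Let E0 : 0 <= E.
Proof. by apply: le_trans E_day; rewrite mulr_ge0 // exprn_ge0 //; case/andP: q01. Qed.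

Let pending i := E < c * q ^+ i.

Let pending_le i j : (i <= j)%N -> pending j -> pending i.
Proof.
move=> ij; rewrite /pending => h; apply: (lt_le_trans h); rewrite ler_wpM2l //.
by rewrite -(subnKC ij) exprD ler_piMr ?exprn_ge0 ?exprn_ile1 //; case/andP: q01.
Qed.

Let pending_q i : pending i -> 0 < q ^+ i.
Proof.
move=> h; rewrite lt_neqAle exprn_ge0 ?andbT; last by case/andP: q01.
apply/negP => /eqP q0; by move: h; rewrite /pending -q0 mulr0 ltNge E0.
Qed.

Let FE i : pending i.+1 -> F i.+1 = E / q ^+ i.+1 - (c - 1).
Proof. by rewrite /F /= /pending ltNge => /negbTE ->. Qed.

Let F1 i : ~~ pending i.+1 -> F i.+1 = 1.
Proof. by rewrite /F /= /pending -leNgt => ->. Qed.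

Let FE_ge i : pending i -> F0 <= E / q ^+ i - (c - 1).
Proof.
move=> h; have q0 := pending_q h.
have : E <= E / q ^+ i.
  by rewrite ler_peMr // invf_ge1 // exprn_ile1 //; case/andP: q01.
have : 0 <= D / G%:R by rewrite divr_ge0 // ltW.
by rewrite /E; lra.
Qed.

Lemma catch_up_bounds i : F0 <= F i <= 1.
Proof.
case: i => [|i]; first by rewrite lexx; case/andP: F0_01.
have [h|h] := boolP (pending i.+1); last by rewrite F1 // lexx andbT; case/andP: F0_01.
rewrite FE // FE_ge //=.
have : E / q ^+ i.+1 <= c by rewrite ler_pdivrMr ?pending_q // ltW.
by lra.
Qed.

Lemma catch_up_homo i : F i <= F i.+1.
Proof.
case: i => [|i]; first by case/andP: (catch_up_bounds 1).
have [h|h] := boolP (pending i.+2); last first.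
  by rewrite (F1 h); case/andP: (catch_up_bounds i.+1).
have h' : pending i.+1 by apply: pending_le h.
rewrite !FE // lerD2r ler_wpM2l // lef_pV2 ?posrE ?pending_q //.
by rewrite exprS ler_piMl ?exprn_ge0 //; case/andP: q01.
Qed.

(** The slack is converted at price [G] but spent at price [a * B <= G]: raising the probability of
    all [a] agents by [D / G] costs at most [D]. *)
Let BDG : a%:R * (B%:R * (D / G%:R)) <= D.
Proof.
rewrite !mulrA ler_pdivrMr // mulrC ler_wpM2l // -natrM ler_nat; exact: aBG.
Qed.

Let EF0 : F 0 = F0. Proof. by []. Qed.

(** From the first day on, the cost is the rate [c] minus the slack [D] plus the price of the
    initial jump by [D / G]. The indicator of [n = 0] makes the formula hold before the jump is
    paid, so that the induction has a single statement. *)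
Let cost_pending n : pending n ->
  X + a%:R * stage_cost 1 B%:R F n + (n == 0%N)%:R * (a%:R * (B%:R * (D / G%:R)))
   = c * (x%:R + a%:R * n%:R) - D + a%:R * (B%:R * (D / G%:R)).
Proof.
elim: n => [|n IH] h; first by rewrite stage_cost0 /= mulr0n !mulr0 !addr0 mul1r /D; ring.
have {IH} := IH (pending_le (leqnSn n) h).
rewrite stage_costS FE // -[in X in _ -> X]natr1.
have q0 := pending_q h; have q0' := pending_q (pending_le (leqnSn n) h).
have qq0 : q != 0 by move: q0; rewrite exprS; case: eqP => // ->; rewrite mul0r ltxx.
have HS : E / q ^+ n = (1 - 1 / B%:R) * (E / q ^+ n.+1).
  by rewrite -/q exprS; field; rewrite qq0 gt_eqF.
move: HS; set H := E / q ^+ n.+1; set Z := D / G%:R; set T := stage_cost _ _ _ _.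
have HB : B%:R * ((1 - 1 / B%:R) * H) = B%:R * H - H by field; rewrite gt_eqF.
have [n0|n0] := eqVneq n 0%N.
  rewrite {n h q0 q0'}n0 in H T HB * => HS.
  have h2 : H * (B%:R - 1) = B%:R * E.
    have EH : E = (1 - 1 / B%:R) * H by rewrite -HS expr0 divr1.
    by rewrite [RHS](congr1 ( *%R B%:R) EH) HB; ring.
  have -> : F 0%N = F0 by [].
  have EE : B%:R * E = B%:R * Z + B%:R * (F0 + c - 1) by rewrite /E -/Z; ring.
  rewrite EE in h2.
  have h3 : a%:R * (H * (B%:R - 1)) = a%:R * (B%:R * Z + B%:R * (F0 + c - 1)) by rewrite h2.
  by move=> /= IH; rewrite mul0r addr0; lra.
case: n n0 h q0 q0' @H @T HB => // n _ h q0 q0' H T HB HS.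
rewrite FE ?HS; last exact: pending_le h.
move=> IH; rewrite mul0r addr0.
have h3 : a%:R * (B%:R * ((1 - 1 / B%:R) * H)) = a%:R * (B%:R * H - H) by rewrite HB.
by move: h3 IH; rewrite /= mul0r addr0; lra.
Qed.

Let cost_pending_le n : pending n ->
  X + a%:R * stage_cost 1 B%:R F n <= c * (x + a * n)%:R.
Proof.
move=> h; have := cost_pending h; have := BDG; rewrite natrD natrM.
case: n h => [|n] h; last by rewrite /= mul0r addr0; lra.
by have := D0; rewrite stage_cost0 mulr0 /D; lra.
Qed.

Let cost_completing i : pending i -> ~~ pending i.+1 ->
  X + a%:R * stage_cost 1 B%:R F i.+1
    <= c * (x + a * i)%:R + (a * B)%:R * (c - E / q ^+ i).
Proof.
move=> h h1; rewrite stage_costS F1 // subrr mulr0 add0r.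
have := cost_pending h; have := BDG; rewrite natrD !natrM.
case: i h h1 => [|i] h h1.
  have := D0; rewrite EF0 stage_cost0 expr0 divr1 /E /D; move: (_ / G%:R) => Z.
  by move=> *; lra.
rewrite FE // mul0r addr0; move: (stage_cost _ _ _ _) (E / _) => T H; lra.
Qed.

Let cost_done n m : ~~ pending n.+1 -> (n <= m)%N ->
  stage_cost 1 B%:R F m.+1 = stage_cost 1 B%:R F n.+1.
Proof.
move=> h; elim: m => [|m IH]; first by rewrite leqn0 => /eqP ->.
rewrite leq_eqVlt ltnS => /orP[/eqP -> //|nm].
rewrite -IH // [LHS]stage_costS.
have hn k : (n <= k)%N -> ~~ pending k.+1.
  by move=> nk; apply: contra h; apply: pending_le.
rewrite !F1 ?hn //; first by rewrite subrr !mulr0 !addr0.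
exact: leqW.
Qed.

Let pending_lt i : pending i -> (i < b)%N.
Proof.
move=> h; rewrite ltnNge; apply/negP => bi.
by move: (pending_le bi h); rewrite /pending ltNge E_day.
Qed.

Let pending_le_G i : pending i -> (x + a * i <= G)%N.
Proof.
move=> h; rewrite leqNgt; apply/negP => Gi.
(* Here [j] is the last full day before the benchmark reaches [G]. As [o < a], the factor
   [1 - o / (a * B)] is at least [q], so [E_group] completes the purchase by day [j + 1]. *)
pose j := ((G - x) %/ a)%N; pose o := ((G - x) %% a)%N.
have oa : (o < a)%N by rewrite ltn_pmod.
have jo : (x + a * j + o = G)%N.
  by rewrite -addnA [(a * j)%N]mulnC -divn_eq subnKC.
have ji : (j.+1 <= i)%N.
  rewrite ltnNge; apply/negP => ij.
  move: Gi; rewrite ltnNge -jo -addnA leq_add2l => /negP; apply.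
  by rewrite (leq_trans _ (leq_addr _ _)) // leq_mul2l ij orbT.
have := pending_le ji h; rewrite /pending ltNge => /negP; apply.
apply: le_trans (E_group (ltnW oa) jo); rewrite exprSr mulrA ler_wpM2l //.
  by rewrite mulr_ge0 // exprn_ge0 //; case/andP: q01.
rewrite /q lerD2l lerN2 natrM invfM mulrA ler_wpM2r ?invr_ge0 ?(ltW B0') //.
by rewrite ler_pdivrMr // mul1r ler_nat ltnW.
Qed.

Lemma catch_up_cost n :
  X + a%:R * stage_cost 1 B%:R F n <= c * (minn G (x + a * minn n b))%:R.
Proof.
have [h|h] := boolP (pending n).
  apply: (le_trans (cost_pending_le h)); rewrite ler_wpM2l // ler_nat.
  by rewrite leq_min pending_le_G //= (minn_idPl (ltnW (pending_lt h))).
case: n h => [|n] h.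
  rewrite stage_cost0 min0n muln0 addn0 (minn_idPr xG) mulr0 addr0.
  by have := D0; rewrite /D; lra.
(* If [E >= c], then [1 - F0 <= D / G], and the slack pays for the whole purchase on the first
   day. *)
have [p0|p0] := boolP (pending 0); last first.
  rewrite (@cost_done 0) //; last by apply: contra p0; apply: pending_le.
  apply: (@le_trans _ _ (c * x%:R)); last first.
    by rewrite ler_wpM2l // ler_nat leq_min xG leq_addr.
  rewrite stage_costS stage_cost0 add0r F1 ?subrr ?mulr0 ?add0r; last first.
    by apply: contra p0; apply: pending_le.
  have : c - F0 - c + 1 <= D / G%:R.
    by move: p0; rewrite /pending expr0 mulr1 -leNgt /E; lra.
  rewrite EF0 => h1; have : a%:R * (B%:R * (1 - F0)) <= a%:R * (B%:R * (D / G%:R)).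
    by rewrite ler_pM2l // ler_pM2l //; lra.
  have := BDG; rewrite /D; lra.
have [i [pi npi iN]] : exists i, [/\ pending i, ~~ pending i.+1 & (i <= n)%N].
  elim: n h => [|n IH] h; first by exists 0%N.
  have [p|/IH[i [? ? ?]]] := boolP (pending n.+1); first by exists n.+1.
  by exists i; split=> //; apply: leqW.
rewrite (cost_done npi iN); apply: (le_trans (cost_completing pi npi)).
have qi := pending_q pi; have ib := pending_lt pi; have iG := pending_le_G pi.
(* The purchase is completed on day [i + 1], so [H i >= c * q]: what is missing costs at most one
   full day of the benchmark. *)
have full : (a * B)%:R * (c - E / q ^+ i) <= c * a%:R.
  have : c * q <= E / q ^+ i.
    by rewrite ler_pdivlMr // -mulrA -exprS; move: npi; rewrite /pending -leNgt.
  rewrite natrM /q => h1.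
  have -> : c * a%:R = a%:R * (B%:R * (c * (1 / B%:R))) by field; rewrite gt_eqF.
  by rewrite -mulrA ler_pM2l // ler_pM2l //; lra.
have [iG'|iG'] := leqP (x + a * i.+1) G.
  apply: (@le_trans _ _ (c * (x + a * i.+1)%:R)).
    by rewrite mulnS addnCA addnC natrD mulrDr; lra.
  rewrite ler_wpM2l // ler_nat leq_min iG' leq_add2l leq_mul2l leq_min.
  by rewrite ltnS iN ib orbT.
(* The benchmark reaches [G] during the completion day and grows by [o] only; [E_group] bounds the
   purchase by [c * o]. *)
pose o := (G - (x + a * i))%N.
have oE : (x + a * i + o = G)%N by rewrite subnKC.
have oa : (o <= a)%N.
  by rewrite /o leq_subLR -addnA [(_ + a)%N]addnC -mulnS ltnW.
rewrite (minn_idPl _); last first.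
  apply: (leq_trans (ltnW iG')); rewrite leq_add2l leq_mul2l leq_min.
  by rewrite ltnS iN ib orbT.
have h1 : c * (1 - o%:R / (a * B)%:R) <= E / q ^+ i.
  by rewrite ler_pdivlMr // mulrAC; exact: E_group.
have EG : G%:R = (x + a * i)%:R + o%:R :> R by rewrite -natrD oE.
rewrite EG mulrDr.
have aB0 : 0 < (a * B)%:R :> R by rewrite ltr0n muln_gt0 a0.
have : (a * B)%:R * (c - E / q ^+ i) <= (a * B)%:R * (c * (o%:R / (a * B)%:R)).
  rewrite (ler_pM2l aB0); move: h1; move: (_ / (a * B)%:R) (E / _) => w H h1; lra.
have -> : (a * B)%:R * (c * (o%:R / (a * B)%:R)) = c * o%:R.
  by rewrite mulrCA [_ * (o%:R / _)]mulrCA divff ?gt_eqF // mulr1.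
lra.
Qed.

End CatchUp.

(* Jensen's inequality for the concave bound [min (G, x + a min (n, b))]. *)
Lemma average_cost_le (I : finType) (A : {pred I}) (nn : I -> nat) (a G x b : nat)
    (c X : R) (C : nat -> R) :
  #|A| = a -> (0 < a)%N -> 0 <= c ->
  (forall n, X + a%:R * C n <= c * (minn G (x + a * minn n b))%:R) ->
  X + \sum_(m in A) C (nn m)
    <= c * (minn G (x + \sum_(m in A) minn (nn m) b))%:R.
Proof.
move=> Aa a0 c0 hC; have a0' : 0 < a%:R :> R by rewrite ltr0n.
have avg : a%:R * (X + \sum_(m in A) C (nn m)) = \sum_(m in A) (X + a%:R * C (nn m)).
  by rewrite big_split /= sumr_const Aa mulrDr mulr_natl -mulr_sumr.
have le1 : X + \sum_(m in A) C (nn m) <= c * G%:R.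
  rewrite -(ler_pM2l a0') avg.
  have -> : a%:R * (c * G%:R) = \sum_(m in A) c * G%:R by rewrite sumr_const Aa mulr_natl.
  apply: ler_sum => m _; apply: (le_trans (hC _)).
  by rewrite ler_wpM2l // ler_nat geq_minl.
have le2 : X + \sum_(m in A) C (nn m) <= c * (x + \sum_(m in A) minn (nn m) b)%:R.
  rewrite -(ler_pM2l a0') avg.
  have -> : a%:R * (c * (x + \sum_(m in A) minn (nn m) b)%:R)
     = \sum_(m in A) c * (x + a * minn (nn m) b)%:R.
    rewrite -mulr_sumr mulrCA; congr (_ * _); rewrite -natrM -natr_sum; congr _%:R.
    by rewrite big_split /= sum_nat_const Aa -big_distrr mulnDr.
  apply: ler_sum => m _; apply: (le_trans (hC _)).
  by rewrite ler_wpM2l // ler_nat geq_minr.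
by case: leqP.
Qed.

End Hedging.

(** * Runs of deterministic policies *)

Section Runs.
Variable M : nat.
Implicit Types (pi : policy M) (N : 'I_M -> nat) (m : 'I_M) (t n d : nat).

Definition played pi N t := joint_action pi (run pi N t).

Definition nactive N t := #|[set m | (t < N m)%N]%SET|.

Definition nbought pi N t := #|[set m | bought (run pi N t) m]%SET|.

Definition buyers (a : {ffun 'I_M -> action}) := [set m | is_buy (a m)]%SET.

Lemma size_run pi N t : size (run pi N t) = t.
Proof. by elim: t => //= t IH; rewrite size_rcons IH. Qed.

Lemma inactive_run pi N t m : inactive (run pi N t) m = (0 < N m <= t)%N.
Proof.
elim: t => [|t IH]; first by rewrite /inactive /=; case: (N m).
rewrite /= /inactive has_rcons /= inE -/(inactive (run pi N t) m) IH.
by case: (N m) => [//|n] /=; rewrite [(n < t.+1)%N]leq_eqVlt.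
Qed.

Lemma boughtS pi N t m : bought (run pi N t.+1) m =
  bought (run pi N t) m || is_buy (played pi N t m).
Proof. by rewrite /= /bought has_rcons orbC. Qed.

Lemma played_bought pi N t m : bought (run pi N t) m -> played pi N t m = None.
Proof. by move=> h; rewrite /played ffunE /eligible h andbF. Qed.

Lemma bought_homo pi N m t t' : (t <= t')%N ->
  bought (run pi N t) m -> bought (run pi N t') m.
Proof.
move=> /subnKC <-; elim: (t' - t)%N => [|k IH]; first by rewrite addn0.
by move=> h; rewrite addnS boughtS IH.
Qed.

(** The inequality [t < d] is strict because the record of day [d] tells the agents that leave on
    day [d] from those that stay longer. *)
Lemma eq_run pi N N' d t : (forall m, minn (N m) d = minn (N' m) d) ->
  (t < d)%N -> run pi N t = run pi N' t.
Proof.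
move=> NN'; elim: t => [//|t IH] td; rewrite /= IH; last exact: ltnW.
congr rcons; congr pair; apply/setP => m; rewrite !inE.
by have := NN' m; case: (ltngtP (N m) d) td; case: (ltngtP (N' m) d); lia.
Qed.

Lemma nth_run pi N n t r0 : (t < n)%N -> (nth r0 (run pi N n) t).1 = played pi N t.
Proof.
elim: n => // n IH; rewrite ltnS leq_eqVlt => /orP[/eqP ->|tn] /=.
  by rewrite nth_rcons size_run ltnn eqxx.
by rewrite nth_rcons size_run tn IH.
Qed.

Lemma nbought_sum pi N n :
  nbought pi N n = (\sum_(t < n) #|buyers (played pi N t)|)%N.
Proof.
elim: n => [|n IH].
  by rewrite big_ord0 /nbought; apply/eqP; rewrite cards_eq0; apply/eqP/setP => m; rewrite !inE.
rewrite big_ord_recr /= -IH /nbought.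
have -> : [set m | bought (run pi N n.+1) m]%SET =
  ([set m | bought (run pi N n) m] :|: buyers (played pi N n))%SET.
  apply/setP => m.
  by rewrite finset.in_setU finset.in_set finset.in_set [in RHS]finset.in_set boughtS.
rewrite cardsU; set I := (_ :&: _)%SET.
have -> : I = finset.set0; last by rewrite cards0 subn0.
apply/setP => m; rewrite finset.in_setI !finset.in_set; apply/negbTE; apply/negP => /andP[h].
by rewrite played_bought.
Qed.

Lemma nactive_le pi N t : (forall m, 0 < N m)%N ->
  (nactive N t <= #|[set m | played pi N t m == Some Rent]%SET| + nbought pi N t.+1)%N.
Proof.
move=> N0; rewrite /nactive /nbought.
apply: leq_trans (_ : #|([set m | played pi N t m == Some Rent] :|:
  [set m | bought (run pi N t.+1) m])%SET| <= _)%N; last by rewrite cardsU leq_subr.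
apply/subset_leq_card/fintype.subsetP => m; rewrite finset.in_setU !finset.in_set boughtS => tN.
case: (boolP (bought _ m)) => //= nb; first by rewrite orbT.
rewrite /played ffunE /eligible inactive_run nb N0 -ltnNge tN /=.
by case: (pi _ m).
Qed.

Lemma buyers_active pi N t m : (forall m, 0 < N m)%N ->
  is_buy (played pi N t m) -> (t < N m)%N.
Proof.
move=> N0; rewrite /played ffunE /eligible inactive_run N0 /= -ltnNge.
by case: (t < N m)%N.
Qed.

End Runs.

(** * Prices of passes and lower bounds for the cost of one day *)

Section Prices.
Variables (R : realType) (M B G : nat).
Implicit Types (pi : policy M) (N : 'I_M -> nat) (m : 'I_M) (t n d : nat).
Implicit Types (a : {ffun 'I_M -> action}).

(* [min (G / k, B)], the price for each of [k] agents that buy on the same day *)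
Definition pass_price (k : nat) : R :=
  if (G <= k * B)%N then G%:R / k%:R else B%:R.

Definition spent a : R := \sum_(m | is_buy (a m)) price R B G a m.

Definition total_spent pi N n : R := \sum_(t < n) spent (played pi N t).

Hypotheses (G0 : (0 < G)%N) (B0 : (0 < B)%N).

Lemma price_ge0 a m : 0 <= price R B G a m.
Proof. by rewrite /price; case: (a m) => [[]|] //; rewrite divr_ge0. Qed.

Lemma spent_ge0 a : 0 <= spent a.
Proof. by apply: sumr_ge0 => m _; apply: price_ge0. Qed.

Lemma pass_price_ge0 k : 0 <= pass_price k.
Proof. by rewrite /pass_price; case: ifP => _ //; rewrite divr_ge0. Qed.

Lemma sum_price a :
  \sum_m price R B G a m = #|[set m | a m == Some Rent]%SET|%:R + spent a.
Proof.
rewrite (bigID (fun m => is_buy (a m))) /= addrC; congr (_ + _).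
rewrite (bigID (fun m => a m == Some Rent)) /= [X in _ + X]big1 ?addr0; last first.
  by move=> m; rewrite /price; case: (a m) => [[]|].
rewrite (eq_bigr (fun=> 1)); last first.
  by move=> m /andP[_ /eqP am]; rewrite /price am.
rewrite sumr_const -[RHS]mulr1n; congr (_ *+ _); apply: eq_card => m.
by rewrite finset.in_set unfold_in /=; case: eqP => [->|]; rewrite ?andbF.
Qed.

(** At most [k] buyers share a group pass, so nobody pays less than when all [k] join and the
    cheaper kind of pass is chosen. *)
Lemma price_buy_ge a m k : is_buy (a m) -> (#|buyers a| <= k)%N ->
  pass_price k <= price R B G a m.
Proof.
move=> am ak; have j0 : (0 < #|buyers a|)%N by apply/card_gt0P; exists m; rewrite finset.in_set.
have k0 : 0 < k%:R :> R by rewrite ltr0n (leq_trans j0 ak).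
have gB : pass_price k <= B%:R.
  rewrite /pass_price; case: ifP => // GkB.
  by rewrite ler_pdivrMr // -natrM ler_nat mulnC.
rewrite /price; case E: (a m) am => [[]|] // _ //.
set j := #|_|; have jk : (j <= k)%N.
  apply: leq_trans ak; apply/subset_leq_card/fintype.subsetP => i.
  by rewrite !finset.in_set /is_buy => ->; rewrite orbT.
have j0' : 0 < j%:R :> R by rewrite ltr0n; apply/card_gt0P; exists m; rewrite finset.in_set E.
apply: (@le_trans _ _ (G%:R / k%:R)); last first.
  by rewrite ler_wpM2l // lef_pV2 ?posrE // ler_nat.
rewrite /pass_price; case: ifP => // /negbT; rewrite -ltnNge => /ltnW kBG.
by rewrite ler_pdivlMr // -natrM ler_nat mulnC.
Qed.

Lemma spent_ge_Ind a k : (k * B < G)%N -> (#|buyers a| <= k)%N ->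
  B%:R * #|buyers a|%:R <= spent a.
Proof.
move=> kBG ak; rewrite /spent mulr_natr.
rewrite (_ : B%:R *+ _ = \sum_(m | is_buy (a m)) B%:R); last first.
  by rewrite sumr_const; congr (_ *+ _); apply: eq_card => m; rewrite finset.in_set.
apply: ler_sum => m am; have := price_buy_ge am ak.
by rewrite /pass_price leqNgt kBG.
Qed.

Lemma spent_group a : (exists m, a m = Some Defs.Group) -> G%:R <= spent a.
Proof.
case=> m am; rewrite /spent (bigID (fun m => a m == Some Defs.Group)) /= -[X in X <= _]addr0.
apply: lerD; last by apply: sumr_ge0 => i _; apply: price_ge0.
rewrite (eq_bigl (fun m => a m == Some Defs.Group)); last first.
  by move=> i; rewrite /is_buy; case: (a i) => [[]|].
set j := #|[set k | a k == Some Defs.Group]%SET|.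
rewrite (eq_bigr (fun=> G%:R / j%:R)); last by move=> i /eqP ai; rewrite /price ai.
rewrite sumr_const -[X in _ <= X]mulr_natr.
have -> : #|[pred i | a i == Some Defs.Group]| = j by apply: eq_card => i; rewrite finset.in_set.
by rewrite divfK // pnatr_eq0 -lt0n; apply/card_gt0P; exists m; rewrite finset.in_set am.
Qed.

Lemma spent_no_group a : (forall m, a m <> Some Defs.Group) ->
  spent a = B%:R * #|buyers a|%:R.
Proof.
move=> ng; rewrite /spent mulr_natr (eq_bigr (fun=> B%:R)).
  by rewrite sumr_const; congr (_ *+ _); apply: eq_card => m; rewrite finset.in_set.
move=> m; rewrite /price; have := ng m; by case: (a m) => [[]|].
Qed.

Lemma total_spentS pi N n :
  total_spent pi N n.+1 = total_spent pi N n + spent (played pi N n).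
Proof. by rewrite /total_spent big_ord_recr. Qed.

Lemma total_spent_ge0 pi N n : 0 <= total_spent pi N n.
Proof. by apply: sumr_ge0 => t _; apply: spent_ge0. Qed.

Definition spent_fraction pi N n : R := Num.min 1 (total_spent pi N n / G%:R).

Let G0' : 0 < G%:R :> R. Proof. by rewrite ltr0n. Qed.

Lemma spent_fraction_bounds pi N n : 0 <= spent_fraction pi N n <= 1.
Proof.
rewrite /spent_fraction le_min ler01 divr_ge0 ?total_spent_ge0 //=.
by rewrite ge_min lexx.
Qed.

Lemma spent_fraction_homo pi N n : spent_fraction pi N n <= spent_fraction pi N n.+1.
Proof.
rewrite /spent_fraction le_min ge_min lexx /= ge_min; apply/orP; right.
by rewrite ler_pM2r ?invr_gt0 // total_spentS lerDl spent_ge0.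
Qed.

(* While [G <= k B], one agent in [k] costs at least as much individually as a
   share [1 / k] of the group pass: a fraction [x / G] of the group pass covers
   at least as many agents as [x] spent on individual passes. *)
Lemma day_cost_group pi N t : (forall m, 0 < N m)%N -> (G <= nactive N t * B)%N ->
  (nactive N t)%:R * (1 - spent_fraction pi N t.+1) +
    G%:R * (spent_fraction pi N t.+1 - spent_fraction pi N t)
  <= \sum_m price R B G (played pi N t) m.
Proof.
move=> N0 GkB; rewrite sum_price; set k := nactive N t.
apply: lerD; last first.
  rewrite -ler_pdivlMl // lerBlDr -[X in _ <= _ + X]/(Num.min _ _).
  have h : 0 <= G%:R^-1 * spent (played pi N t) by rewrite mulr_ge0 ?invr_ge0 ?spent_ge0.
  rewrite /spent_fraction total_spentS mulrDl [spent _ / _]mulrC.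
  by rewrite /Num.min; case: ifP; case: ifP; lra.
rewrite /spent_fraction; case: (leP 1 (total_spent pi N t.+1 / G%:R)) => [_|lt1].
  by rewrite subrr mulr0.
have ltG : total_spent pi N t.+1 < G%:R by move: lt1; rewrite ltr_pdivrMr // mul1r.
(* One group purchase alone would bring the amount spent to [G]. Hence only individual passes have
   been bought, and the amount is [B] times their number. *)
have ng t' : (t' < t.+1)%N -> forall m, played pi N t' m <> Some Defs.Group.
  move=> t't m am; move: ltG; rewrite ltNge => /negP; apply.
  rewrite /total_spent (bigD1 (Ordinal t't)) //= -[X in X <= _]addr0 lerD //.
    by apply: spent_group; exists m.
  by apply: sumr_ge0 => i _; apply: spent_ge0.
have -> : total_spent pi N t.+1 = B%:R * (nbought pi N t.+1)%:R.
  rewrite nbought_sum natr_sum mulr_sumr; apply: eq_bigr => i _.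
  by apply: spent_no_group; apply: ng.
have : (k%:R <= #|[set m | played pi N t m == Some Rent]%SET|%:R + (nbought pi N t.+1)%:R :> R).
  by rewrite -natrD ler_nat; apply: nactive_le.
move: (nbought pi N t.+1)%:R (ler0n R (nbought pi N t.+1)) #|_|%:R => b b0 r kr.
have : b <= k%:R * (B%:R * b / G%:R).
  by rewrite !mulrA -natrM mulrAC ler_peMl // ler_pdivlMr // mul1r ler_nat.
by rewrite mulrBr mulr1; lra.
Qed.

Lemma day_cost_Ind pi N t k : (forall m, 0 < N m)%N -> nactive N t = k ->
  (0 < k)%N -> (k * B < G)%N ->
  k%:R * ((1 - (nbought pi N t.+1)%:R / k%:R) +
    B%:R * ((nbought pi N t.+1)%:R / k%:R - (nbought pi N t)%:R / k%:R))
  <= \sum_m price R B G (played pi N t) m.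
Proof.
move=> N0 kE k0 kBG; rewrite sum_price.
have k0' : k%:R != 0 :> R by rewrite pnatr_eq0 -lt0n.
have ES : nbought pi N t.+1 = (nbought pi N t + #|buyers (played pi N t)|)%N.
  by rewrite !nbought_sum big_ord_recr.
have -> : k%:R * ((1 - (nbought pi N t.+1)%:R / k%:R) +
    B%:R * ((nbought pi N t.+1)%:R / k%:R - (nbought pi N t)%:R / k%:R))
  = k%:R - (nbought pi N t.+1)%:R + B%:R * #|buyers (played pi N t)|%:R :> R.
  by rewrite ES natrD; field; rewrite k0'.
apply: lerD; last first.
  apply: (@spent_ge_Ind _ k) => //; rewrite -kE; apply/subset_leq_card/fintype.subsetP => m.
  by rewrite !finset.in_set; apply: buyers_active.
by rewrite lerBlDr -natrD ler_nat -kE; apply: nactive_le.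
Qed.

Lemma day_cost_agent pi N t m : (forall m, 0 < N m)%N -> (t < N m)%N ->
  (1 - (bought (run pi N t.+1) m)%:R) + pass_price (nactive N t) *
    ((bought (run pi N t.+1) m)%:R - (bought (run pi N t) m)%:R)
  <= price R B G (played pi N t) m.
Proof.
move=> N0 tN; rewrite boughtS; case: (boolP (bought _ m)) => [b|nb] /=.
  by rewrite !subrr mulr0 addr0; apply: price_ge0.
case: (boolP (is_buy _)) => [am|am] /=.
  rewrite subrr add0r subr0 mulr1; apply: price_buy_ge => //.
  apply/subset_leq_card/fintype.subsetP => i.
  by rewrite !finset.in_set; apply: buyers_active.
rewrite !subr0 mulr0 addr0 /price; move: am.
rewrite /played ffunE /eligible inactive_run nb N0 -ltnNge tN /=.
by case: (pi _ m).
Qed.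

Lemma agent_costE pi N m :
  agent_cost R B G m pi N = \sum_(t < N m) price R B G (played pi N t) m.
Proof. by []. Qed.

Lemma price_inactive pi N t m : (0 < N m <= t)%N -> price R B G (played pi N t) m = 0.
Proof. by move=> h; rewrite /price /played ffunE /eligible inactive_run h. Qed.

Lemma total_costE pi N n : (forall m, 0 < N m <= n)%N ->
  total_cost R B G pi N = \sum_(t < n) \sum_m price R B G (played pi N t) m.
Proof.
move=> Nn; rewrite /total_cost exchange_big /=; apply: eq_bigr => m _.
rewrite agent_costE; have /andP[N0 Nmn] := Nn m.
rewrite -!(big_mkord predT (fun t => price R B G (played pi N t) m)).
rewrite (big_cat_nat (leq0n _) Nmn) /= [X in _ + X]big_nat_cond [X in _ + X]big1 ?addr0 //.
by move=> t /andP[/andP[h _] _]; apply: price_inactive; rewrite N0.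
Qed.

End Prices.

Local Open Scope classical_set_scope.
Local Open Scope ring_scope.

(** * Expectations over policies *)

Section BoundedExpectation.
Context d (T : measurableType d) (R : realType) (P : probability T R).
Implicit Types f g : T -> R.

Definition bounded_measurable f :=
  measurable_fun setT f /\ exists C, forall x, `|f x| <= C.

Lemma eq_bounded_measurable f g : f =1 g -> bounded_measurable f -> bounded_measurable g.
Proof. by move=> /funext ->. Qed.

Lemma bounded_measurable_cst (c : R) : bounded_measurable (fun=> c).
Proof. by split; [exact: measurable_cst | exists `|c|]. Qed.

Lemma bounded_measurableD f g : bounded_measurable f -> bounded_measurable g ->
  bounded_measurable (fun x => f x + g x).
Proof.
move=> [mf [C hC]] [mg [C' hC']]; split; first exact: measurable_funD.
by exists (C + C') => x; rewrite (le_trans (ler_normD _ _)) // lerD.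
Qed.

Lemma bounded_measurableZ (c : R) f : bounded_measurable f ->
  bounded_measurable (fun x => c * f x).
Proof.
move=> [mf [C hC]]; split.
  by apply: measurable_funM => //; exact: measurable_cst.
by exists (`|c| * C) => x; rewrite normrM ler_wpM2l.
Qed.

Lemma bounded_measurableB f g : bounded_measurable f -> bounded_measurable g ->
  bounded_measurable (fun x => f x - g x).
Proof.
move=> hf hg; have := bounded_measurableD hf (bounded_measurableZ (-1) hg).
by under eq_fun do rewrite mulN1r.
Qed.

Lemma bounded_measurable_sum (I : Type) (r : seq I) (Q : pred I) (F : I -> T -> R) :
  (forall i, Q i -> bounded_measurable (F i)) ->
  bounded_measurable (fun x => \sum_(i <- r | Q i) F i x).
Proof.
move=> hF; elim: r => [|i r IH].
  by under eq_fun do rewrite big_nil; exact: bounded_measurable_cst.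
under eq_fun do rewrite big_cons.
by case: (boolP (Q i)) => // Qi; apply: bounded_measurableD => //; apply: hF.
Qed.

Lemma bounded_measurable_integrable f : bounded_measurable f ->
  P.-integrable setT (EFin \o f).
Proof.
move=> [mf [C hC]]; apply: measurable_bounded_integrable => //.
  by apply: le_lt_trans (ltry 1); apply: (probability_le1 P).
by exists C; split; [exact: num_real | move=> x xC y _; exact: (le_trans (hC y) (ltW xC))].
Qed.

Definition mean f : R := \int[P]_x f x.

Lemma meanE f : bounded_measurable f -> (\int[P]_x (f x)%:E)%E = (mean f)%:E.
Proof.
move=> hf; rewrite /mean /Rintegral fineK //.
by apply: integrable_fin_num => //; exact: bounded_measurable_integrable.
Qed.

Lemma mean_cst (c : R) : mean (fun=> c) = c.
Proof. by rewrite /mean Rintegral_cst // -[X in _ * X]/(fine (P setT)) probability_setT mulr1. Qed.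

Lemma meanD f g : bounded_measurable f -> bounded_measurable g ->
  mean (fun x => f x + g x) = mean f + mean g.
Proof. by move=> hf hg; rewrite /mean RintegralD //; exact: bounded_measurable_integrable. Qed.

Lemma meanB f g : bounded_measurable f -> bounded_measurable g ->
  mean (fun x => f x - g x) = mean f - mean g.
Proof. by move=> hf hg; rewrite /mean RintegralB //; exact: bounded_measurable_integrable. Qed.

Lemma meanZ (c : R) f : bounded_measurable f -> mean (fun x => c * f x) = c * mean f.
Proof. by move=> hf; rewrite /mean RintegralZl //; exact: bounded_measurable_integrable. Qed.

Lemma mean_sum (I : Type) (r : seq I) (Q : pred I) (F : I -> T -> R) :
  (forall i, Q i -> bounded_measurable (F i)) ->
  mean (fun x => \sum_(i <- r | Q i) F i x) = \sum_(i <- r | Q i) mean (F i).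
Proof.
move=> hF; elim: r => [|i r IH].
  by under eq_fun do rewrite big_nil; rewrite mean_cst big_nil.
under eq_fun do rewrite big_cons; rewrite big_cons.
case: (boolP (Q i)) => // Qi; rewrite meanD ?IH //; first exact: hF.
exact: bounded_measurable_sum.
Qed.

Lemma ae_mono (A A' : T -> Prop) : (forall x, A x -> A' x) ->
  {ae P, forall x, A x} -> {ae P, forall x, A' x}.
Proof. by move=> AA'; apply: filterS. Qed.

Lemma ae_eq_mean f g : bounded_measurable f -> bounded_measurable g ->
  {ae P, forall x, f x = g x} -> mean f = mean g.
Proof.
move=> [mf _] [mg _] fg; rewrite /mean /Rintegral; congr fine.
apply: ae_eq_integral => //; try exact/measurable_EFinP.
by apply: filterS fg => x /= -> _.
Qed.

Lemma ae_le_mean f g : bounded_measurable f -> bounded_measurable g ->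
  {ae P, forall x, f x <= g x} -> mean f <= mean g.
Proof.
move=> hf hg fg.
(* The maximum dominates [f] everywhere and equals [g] almost everywhere, which reduces the claim to
   pointwise monotonicity. *)
have hm : bounded_measurable (fun x => Num.max (f x) (g x)).
  have [[mf [C hC]] [mg [C' hC']]] := (hf, hg); split; first exact: measurable_maxr.
  by exists (Num.max C C') => x; rewrite le_max /Num.max; case: ifP => _; rewrite ?hC' ?hC ?orbT.
rewrite -(@ae_eq_mean (fun x => Num.max (f x) (g x)) g) //; last first.
  by apply: filterS fg => x /= fgx; exact/max_idPr.
apply: le_Rintegral => //; try exact: bounded_measurable_integrable.
by move=> x _; rewrite le_max lexx.
Qed.

Lemma mean_le f g : bounded_measurable f -> bounded_measurable g ->
  (forall x, f x <= g x) -> mean f <= mean g.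
Proof. by move=> hf hg fg; apply: ae_le_mean => //; exact: nearW. Qed.

Lemma mean_bounds f (a b : R) : bounded_measurable f -> (forall x, a <= f x <= b) ->
  a <= mean f <= b.
Proof.
move=> hf ab; rewrite -{1}(mean_cst a) -(mean_cst b) !ae_le_mean //;
  try exact: bounded_measurable_cst;
  by apply: nearW => x; case/andP: (ab x).
Qed.

(** Costs are affine in the purchase fractions. This is why bounds valid for each deterministic
    policy pass to the averaged law. *)
Lemma mean_stage (I : Type) (r : seq I) (al be : I -> R) (F F' : I -> T -> R) :
  (forall i, bounded_measurable (F i)) -> (forall i, bounded_measurable (F' i)) ->
  mean (fun x => \sum_(i <- r) (al i * (1 - F' i x) + be i * (F' i x - F i x)))
   = \sum_(i <- r) (al i * (1 - mean (F' i)) + be i * (mean (F' i) - mean (F i))).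
Proof.
move=> hF hF'; have h1 := bounded_measurable_cst 1.
have hB i := bounded_measurableB h1 (hF' i).
have hD i := bounded_measurableB (hF' i) (hF i).
rewrite mean_sum => [|i _]; last by apply: bounded_measurableD; exact: bounded_measurableZ.
apply: eq_bigr => i _; rewrite meanD ?meanZ //; try exact: bounded_measurableZ.
by rewrite !meanB // mean_cst.
Qed.

Lemma bounded_measurable_stage (I : Type) (r : seq I) (al be : I -> R) (F F' : I -> T -> R) :
  (forall i, bounded_measurable (F i)) -> (forall i, bounded_measurable (F' i)) ->
  bounded_measurable
    (fun x => \sum_(i <- r) (al i * (1 - F' i x) + be i * (F' i x - F i x))).
Proof.
move=> hF hF'; apply: bounded_measurable_sum => i _.
apply: bounded_measurableD; apply: bounded_measurableZ; last exact: bounded_measurableB.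
by apply: bounded_measurableB => //; exact: bounded_measurable_cst.
Qed.

End BoundedExpectation.

(** * Measurability of functions of a run *)

Section PolicySpace.
Variables (M : nat).
Implicit Types (N : 'I_M -> nat) (t n : nat).
Local Notation policies := (g_sigma_algebraType (@cylinders M)).

Lemma measurable_cylinder (h : history M) m a :
  measurable ([set pi | pi h m = a] : set policies).
Proof. by apply: sub_sigma_algebra; exists h, m, a. Qed.

Lemma measurable_joint_action (h : history M) a :
  measurable ([set pi | joint_action pi h = a] : set policies).
Proof.
have -> : [set pi : policies | joint_action pi h = a] =
    \bigcap_(m in [set: 'I_M]) [set pi : policies | joint_action pi h m = a m].
  apply/seteqP; split=> [pi /= hpi m _ /=|pi hpi] /=; first by rewrite -hpi.
  by apply/ffunP => m; apply: hpi.
apply: fin_bigcap_measurable => [|m _]; first exact: finite_finset.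
have [e|ne] := boolP (eligible h m); last first.
  have [am|am] := eqVneq (a m) None.
    rewrite [X in measurable X](_ : _ = setT) //.
    by apply/seteqP; split=> // pi _ /=; rewrite ffunE (negbTE ne) am.
  rewrite [X in measurable X](_ : _ = set0) //.
  apply/seteqP; split=> // pi /=; rewrite ffunE (negbTE ne) => Ea.
  by rewrite -Ea in am.
case Ea : (a m) => [b|].
  rewrite [X in measurable X](_ : _ = [set pi : policies | pi h m = b]).
    exact: measurable_cylinder.
  by apply/seteqP; split=> pi /=; rewrite ffunE e; [case | move=> ->].
rewrite [X in measurable X](_ : _ = set0) //.
by apply/seteqP; split=> // pi /=; rewrite ffunE e.
Qed.

Lemma measurable_run_eq N t (h : history M) :
  measurable ([set pi | run pi N t = h] : set policies).
Proof.
elim: t h => [|t IH] h /=.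
  have [->|nh] := eqVneq h [::].
    by rewrite [X in measurable X](_ : _ = setT) //; apply/seteqP.
  rewrite [X in measurable X](_ : _ = set0) //.
  by apply/seteqP; split=> // pi /= E; rewrite -E eqxx in nh.
case/lastP: h => [|h r].
  rewrite [X in measurable X](_ : _ = set0) //.
  by apply/seteqP; split=> // pi /=; case: (run _ _ _).
have [Er|nr] := eqVneq r.2 [set m | N m == t.+1]%SET; last first.
  rewrite [X in measurable X](_ : _ = set0) //; apply/seteqP; split=> // pi /=.
  by move=> /rcons_inj[_ E]; rewrite -E eqxx in nr.
rewrite [X in measurable X](_ : _ = [set pi : policies | run pi N t = h] `&`
    [set pi : policies | joint_action pi h = r.1]).
  by apply: measurableI; [exact: IH | exact: measurable_joint_action].
apply/seteqP; split=> pi /=; first by move=> /rcons_inj[<- <-].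
by move=> [-> ->]; rewrite -Er; case: r {Er}.
Qed.

(** No regularity of [chi] is needed: there are countably many histories, so a preimage is a
    countable union of events that fix the run. *)
Lemma measurable_fun_run (R : realType) N n (chi : history M -> R) :
  measurable_fun setT (fun pi : policies => chi (run pi N n)).
Proof.
move=> _ Y mY; rewrite setTI.
pose F (i : nat) : set policies :=
  if @unpickle (seq ({ffun 'I_M -> option move} * {set 'I_M})) i is Some h then
    if chi h \in Y then [set pi : policies | run pi N n = h] else set0 else set0.
rewrite [X in measurable X](_ : _ = \bigcup_i F i).
  apply: bigcup_measurable => i _; rewrite /F; case: unpickle => // h.
  by case: ifP => _ //; exact: measurable_run_eq.
apply/seteqP; split=> pi /=.
  move=> hY; exists (@pickle (seq ({ffun 'I_M -> option move} * {set 'I_M})) (run pi N n)) => //.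
  by rewrite /F pickleK; rewrite ifT // inE.
by move=> [i _]; rewrite /F; case: unpickle => // h; case: ifP => // /[!inE] ? ->.
Qed.

Lemma bounded_measurable_run (R : realType) N n (chi : history M -> R) (C : R) :
  (forall pi, `|chi (run pi N n)| <= C) ->
  bounded_measurable (fun pi : policies => chi (run pi N n)).
Proof. by move=> hC; split; [exact: measurable_fun_run | exists C]. Qed.

Variables (R : realType) (B G : nat).

Let r0 : day_record M := ([ffun=> None], finset.set0).

Lemma bounded_measurable_sum_played N n (psi : nat -> {ffun 'I_M -> action} -> R) (C : R) :
  (forall t a, `|psi t a| <= C) ->
  bounded_measurable (fun pi : policies => \sum_(t < n) psi t (played pi N t)).
Proof.
move=> hC; pose chi (h : history M) := \sum_(t < n) psi t (nth r0 h t).1.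
have E pi : \sum_(t < n) psi t (played pi N t) = chi (run pi N n).
  by apply: eq_bigr => t _; rewrite nth_run.
apply: (@eq_bounded_measurable _ policies R _ _ (fun pi => esym (E pi))).
apply: (@bounded_measurable_run _ _ _ _ (n%:R * C)) => pi.
apply: le_trans (ler_norm_sum _ _ _) _; apply: (@le_trans _ _ (\sum_(t < n) C)).
  by apply: ler_sum => t _; apply: hC.
by rewrite sumr_const card_ord mulr_natl.
Qed.

Lemma price_le (a : {ffun 'I_M -> action}) (m : 'I_M) : price R B G a m <= 1 + B%:R + G%:R.
Proof.
have b0 : 0 <= B%:R :> R by []. have g0 : 0 <= G%:R :> R by [].
rewrite /price; case: (a m) => [[]|]; try lra.
set j := #|_|; have [->|j0] := posnP j; first by rewrite invr0 mulr0; lra.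
have : G%:R / j%:R <= G%:R :> R by rewrite ler_pdivrMr ?ltr0n // ler_peMr // ler1n.
lra.
Qed.

Lemma bounded_measurable_agent_cost N m :
  bounded_measurable (fun pi : policies => agent_cost R B G m pi N).
Proof.
apply: (@bounded_measurable_sum_played _ _ (fun _ a => price R B G a m) (1 + B%:R + G%:R)).
by move=> _ a; rewrite ger0_norm ?price_le // price_ge0.
Qed.

Lemma bounded_measurable_nbought N n :
  bounded_measurable (fun pi : policies => (nbought pi N n)%:R : R).
Proof.
have E pi : \sum_(t < n) #|buyers (played pi N t)|%:R = (nbought pi N n)%:R :> R.
  by rewrite nbought_sum natr_sum.
apply: (@eq_bounded_measurable _ policies R _ _ E).
apply: (@bounded_measurable_sum_played _ _ (fun _ a => #|buyers a|%:R) M%:R).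
by move=> _ a; rewrite ger0_norm // ler_nat (leq_trans (max_card _)) // card_ord.
Qed.

Lemma bounded_measurable_bought N n m :
  bounded_measurable (fun pi : policies => (bought (run pi N n) m)%:R : R).
Proof.
apply: (@bounded_measurable_run _ _ _ (fun h => (bought h m)%:R) 1) => pi.
by case: bought; rewrite ?normr1 ?normr0.
Qed.

Lemma bounded_measurable_spent_fraction N n :
  bounded_measurable (fun pi : policies => spent_fraction R B G pi N n).
Proof.

pose chi (h : history M) : R :=
  Num.min 1 ((\sum_(t < n) spent R B G (nth r0 h t).1) / G%:R).
have E pi : spent_fraction R B G pi N n = chi (run pi N n).
  rewrite /spent_fraction /chi; congr (Num.min _ (_ / _)).
  by apply: eq_bigr => t _; rewrite nth_run.
apply: (@eq_bounded_measurable _ policies R _ _ (fun pi => esym (E pi))).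
apply: (@bounded_measurable_run _ _ _ _ 1) => pi; rewrite -E.
by have /andP[h0 h1] := @spent_fraction_bounds R M B G pi N n; rewrite ger0_norm.
Qed.

End PolicySpace.

(** * Threshold policies *)

Lemma filter_initial (T : Type) (P : pred T) (r : seq T) :
  pairwise (fun a b => P b ==> P a) r -> seq.filter P r = take (count P r) r.
Proof.
elim: r => //= x r IH /andP[xr /IH ->]; case: (boolP (P x)) => Px.
  by rewrite add1n.
rewrite add0n; suff -> : count P r = 0%N by rewrite !take0.
apply/eqP; rewrite -leqn0 leqNgt -has_count -all_predC.
by apply: sub_all xr => y /=; rewrite (negbTE Px) implybF.
Qed.

Section States.
Variable M : nat.
Implicit Types (pi : policy M) (N : 'I_M -> nat) (m : 'I_M) (t n d : nat).

(** As [N] is nondecreasing, the agents that have left form an initial segment, so the entry at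
    position [m] belongs to agent [m]; the default [x] stands for every agent still active. *)
Lemma nth_state_before N t x m : instance N ->
  nth x (state_before N t) m = if (N m <= t)%N then N m else x.
Proof.
move=> [_ Nm]; rewrite /state_before.
set P := fun i : 'I_M => (N i <= t)%N.
have En : [seq i <- enum 'I_M | P i] = take (count P (enum 'I_M)) (enum 'I_M).
  apply: filter_initial.
  have : pairwise (fun i j : 'I_M => (i <= j)%N) (enum 'I_M).
    rewrite -(pairwise_map val leq) val_enum_ord -sorted_pairwise ?iota_sorted //.
    exact: leq_trans.
  apply: sub_pairwise => i j ij; apply/implyP; rewrite /P => h.
  exact: leq_trans (Nm _ _ ij) h.
have inm : (m \in [seq i <- enum 'I_M | P i]) = P m by rewrite mem_filter mem_enum andbT.
rewrite En in_take ?mem_enum // index_enum_ord in inm.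
rewrite En -/(P m) -inm; set c := count _ _.
have cM : (c <= size (enum 'I_M))%N by apply: count_size.
case: ltnP => mc; last by rewrite nth_default // size_map size_take_min (minn_idPl cM).
rewrite (nth_map m) ?nth_take ?nth_ord_enum //.
by rewrite size_take_min (minn_idPl cM).
Qed.

Lemma size_state_before N t : (size (state_before N t) + nactive N t)%N = M.
Proof.
rewrite /state_before size_map /nactive -[RHS]card_ord size_filter.
rewrite -(cardC [pred m | (N m <= t)%N]); congr (_ + _)%N.
  by rewrite -sum1_count -sum1_card big_enum_cond.
by apply: eq_card => m; rewrite finset.in_set !inE ltnNge.
Qed.

(** A policy sees only the history, and reads off the state from the departures; the record at index
    [i] is that of day [i + 1]. *)
Definition history_state (h : history M) : seq nat :=
  [seq (find (fun r : day_record M => m \in r.2) h).+1 | m <- enum 'I_M & inactive h m].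

Lemma find_run pi N t m : (0 < N m <= t)%N ->
  find (fun r : day_record M => m \in r.2) (run pi N t) = (N m).-1.
Proof.
elim: t => [|t IH]; first by case: (N m).
move=> /andP[N0 Nt]; rewrite /= -cats1 find_cat.
rewrite -/(inactive (run pi N t) m) inactive_run N0 /=.
case: leqP => [h|h]; first by rewrite IH // N0.
have -> : N m = t.+1 by lia.
by rewrite size_run /= inE eqn_leq h Nt addn0.
Qed.

Lemma history_state_run pi N t : (forall m, 0 < N m)%N ->
  history_state (run pi N t) = state_before N t.
Proof.
move=> N0; rewrite /history_state /state_before.
rewrite (eq_filter (a2 := fun m => (N m <= t)%N)); last first.
  by move=> m; rewrite inactive_run N0.
apply/eq_in_map => m; rewrite mem_filter => /andP[Nt _].
by rewrite find_run ?N0 // prednK.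
Qed.

End States.

(** * From purchase laws to thresholds *)

Section Laws.
Variables (R : realType) (M B G : nat) (s : seq nat).
Hypotheses (G0 : (0 < G)%N) (B0 : (0 < B)%N).
Implicit Types (N : 'I_M -> nat) (m : 'I_M) (t n d : nat).
Implicit Types (Phi : ('I_M -> nat) -> nat -> R).

Definition agree N N' d := forall m, minn (N m) d = minn (N' m) d.

(* [Phi N d] is the probability that the active agents have bought by day [d]
   of the instance [N], as long as they all use the same threshold. *)
Record purchase_law Phi : Prop := PurchaseLaw {
  law_adapted : forall N N' d, agree N N' d -> Phi N d = Phi N' d;
  law_bounds : forall N d, instances_given s N -> 0 <= Phi N d <= 1;
  law_homo : forall N d, instances_given s N -> Phi N d <= Phi N d.+1;
  law_zero : forall N d, instances_given s N -> (d <= last 0%N s)%N -> Phi N d = 0 }.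

Definition extend N d d' : 'I_M -> nat := fun m => if (N m < d)%N then N m else d'.

(** This makes a threshold exist for every sample [u < 1] if no further agent leaves. The value 1
    itself need not be attained. *)
Definition eventually_bought Phi := forall N d (u : R), instances_given s N ->
  (last 0%N s < d)%N -> (exists m, d <= N m)%N -> u < 1 ->
  exists d', u <= Phi (extend N d d') d'.

Definition law_cost Phi m N : R :=
  \sum_(t < N m) (1 * (1 - Phi N t.+1) +
    pass_price R B G (nactive N t) * (Phi N t.+1 - Phi N t)).

Lemma law_homo_leq Phi N d d' : purchase_law Phi -> instances_given s N ->
  (d <= d')%N -> Phi N d <= Phi N d'.
Proof.
move=> hP hN; apply: (homo_leq (@lexx _ R) (@le_trans _ R)) => i.
exact: law_homo.
Qed.

Section Threshold.
Variable Phi : ('I_M -> nat) -> nat -> R.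

(** The instance is unknown to the policy, but by [law_adapted] only its truncation at [d] matters,
    so every agent missing from [sigma] is given [d] active days. The value 1 on states that do not
    extend [s] makes everybody buy at once there. *)
Definition state_law (sigma : seq nat) (d : nat) : R :=
  if (d <= last 0%N s)%N then 0 else
  if take (size s) sigma == s then Phi (fun m => nth d sigma m) d else 1.

Definition threshold (u : R) (sigma : seq nat) : nat :=
  match pselect (exists d, u <= state_law sigma d) with
  | left e => ex_minn e
  | right _ => (last 0%N s).+1
  end.

Definition kind (sigma : seq nat) : move :=
  if (G <= (M - size sigma) * B)%N then Defs.Group else Ind.

Definition threshold_policy (u : R) : policy M := fun h _ =>
  if ((size h).+1 < threshold u (history_state h))%N then Rent
  else kind (history_state h).

Lemma kind_neq_Rent sigma : kind sigma <> Rent.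
Proof. by rewrite /kind; case: ifP. Qed.

Lemma threshold_gt u sigma : 0 < u -> (last 0%N s < threshold u sigma)%N.
Proof.
move=> u0; rewrite /threshold; case: pselect => // e.
case: ex_minnP => d + _; rewrite /state_law; case: leqP => //.
by rewrite leNgt u0.
Qed.

Hypotheses (hPhi : purchase_law Phi) (hE : eventually_bought Phi).

Lemma last_le_state N t : instances_given s N ->
  take (size s) (state_before N t) == s -> (size s <= M)%N -> (last 0%N s <= t)%N.
Proof.
move=> [iN Ns] /eqP st; case: (lastP s) st Ns => // s' x; rewrite last_rcons size_rcons.
move=> st Ns sM; pose m := Ordinal sM.
have := @nth_state_before M N t x.+1 m iN.
rewrite -(nth_take (n0 := (size s').+1)) // st nth_rcons ltnn eqxx.
have : N m = x by rewrite Ns // nth_rcons ltnn eqxx.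
by move=> ->; case: ifP => // _ /eqP; rewrite ltn_eqF.
Qed.

Lemma state_extends N t : instances_given s N -> sorted leq s -> (size s <= M)%N ->
  (last 0%N s <= t)%N -> take (size s) (state_before N t) = s.
Proof.
move=> [iN Ns] ss sM st.
have hi i : (i < size s)%N -> nth (t.+1) (state_before N t) i = nth 0%N s i.
  move=> il; have iM := leq_trans il sM.
  have := @nth_state_before M N t t.+1 (Ordinal iM) iN => /= ->.
  rewrite Ns //= ifT // (leq_trans _ st) // -nth_last.
  by apply: (sorted_leq_nth leq_trans leqnn) => //; rewrite ?inE; lia.
have sz : (size s <= size (state_before N t))%N.
  rewrite leqNgt; apply/negP => h.
  have := hi _ h; rewrite nth_default // => E.
  have : (nth 0%N s (size (state_before N t)) <= t)%N.
    rewrite (leq_trans _ st) // -nth_last.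
    by apply: (sorted_leq_nth leq_trans leqnn) => //; rewrite ?inE; lia.
  by rewrite -E ltnn.
apply: (@eq_from_nth _ 0%N); first by rewrite size_takel.
move=> i; rewrite size_takel // => il; rewrite nth_take // -hi //.
by apply: set_nth_default; apply: leq_trans il sz.
Qed.

Lemma extend_state N t d : instance N ->
  (fun m : 'I_M => nth d (state_before N t) m) = extend N t.+1 d.
Proof. by move=> iN; apply/funext => m; rewrite nth_state_before. Qed.

Hypotheses (s_sorted : sorted leq s) (sM : (size s <= M)%N).

(** By adaptedness, [state_law] of the current state agrees with [Phi N] on all days after the entry
    into [s] up to [t.+1], also on those before the current state was entered. Changing the
    threshold with the state therefore never contradicts an earlier decision. *)
Lemma thresholdP N t m u : instances_given s N -> (t < N m)%N -> 0 < u < 1 ->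
  (threshold u (state_before N t) <= t.+1)%N = (u <= Phi N t.+1).
Proof.
move=> hN tN /andP[u0 u1]; have [iN _] := hN.
set sigma := state_before N t.
have law_on d : (d <= t.+1)%N -> (last 0%N s < d)%N -> (last 0%N s <= t)%N ->
    state_law sigma d = Phi N d.
  move=> dt ld lt; rewrite /state_law leqNgt ld /= /sigma state_extends // eqxx.
  rewrite extend_state //; apply: (law_adapted hPhi) => k; rewrite /extend.
  rewrite ltnS; case: leqP => // h; rewrite minnn (minn_idPr _) //.
  exact: leq_trans dt h.
have e : exists d, u <= state_law sigma d.
  have [st|nst] := boolP (take (size s) sigma == s); last first.
    by exists (last 0%N s).+1; rewrite /state_law ltnn (negbTE nst) ltW.
  have lt := last_le_state hN st sM.
  have [d ud] := @hE N t.+1 u hN lt (ex_intro _ m tN) u1.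
  have [dl|ld] := leqP d (last 0%N s).
    exists t.+1; rewrite law_on //.
    have := ud; rewrite (@law_adapted _ hPhi _ N); last first.
      move=> k; rewrite /extend; case: ifP => // /negbT; rewrite -leqNgt => ?; lia.
    by rewrite (law_zero hPhi) // leNgt u0.
  by exists d; rewrite /state_law leqNgt ld /= st extend_state.
rewrite /threshold; case: pselect => // e'; case: ex_minnP => d ud dmin.
apply/idP/idP => [dt|ut].
  have ld : (last 0%N s < d)%N.
    by rewrite ltnNge; apply/negP => h; move: ud; rewrite /state_law h leNgt u0.
  have lt : (last 0%N s <= t)%N by rewrite -ltnS (leq_trans ld).
  by apply: (le_trans ud); rewrite law_on // law_homo_leq.
have [lt|tl] := leqP (last 0%N s) t.
  by apply: dmin; rewrite law_on.
by move: ut; rewrite (law_zero hPhi) // leNgt u0.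
Qed.

Let pu u := threshold_policy u.

Lemma played_threshold N t m u : instances_given s N -> 0 < u < 1 ->
  (t < N m)%N -> bought (run (pu u) N t) m = false ->
  played (pu u) N t m =
    Some (if u <= Phi N t.+1 then kind (state_before N t) else Rent).
Proof.
move=> hN u01 tN nb; have [[N0 _] _] := hN.
rewrite /played ffunE /eligible inactive_run nb N0 -ltnNge tN /=.
rewrite /pu /threshold_policy history_state_run // size_run.
by rewrite -(thresholdP hN tN u01) ltnNge; case: leqP.
Qed.

Lemma is_buy_kind sigma : is_buy (Some (kind sigma)).
Proof. by rewrite /kind; case: ifP. Qed.

Lemma bought_threshold N t m u : instances_given s N -> 0 < u < 1 ->
  (t <= N m)%N -> bought (run (pu u) N t) m = (u <= Phi N t).
Proof.
move=> hN u01; have /andP[u0 _] := u01.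
elim: t => [|t IH] tN; first by rewrite (law_zero hPhi) //= leNgt u0.
rewrite boughtS IH ?(ltnW tN) //; case: (boolP (u <= Phi N t)) => [h|h] /=.
  by rewrite (le_trans h) // law_homo.
rewrite played_threshold ?IH ?(negbTE h) ?(ltnW tN) //.
by case: ifP => _ //; rewrite is_buy_kind.
Qed.

(** All active agents buy on the same day, so a group pass is shared by exactly [nactive N t] of
    them, and [kind] selects the cheaper pass. *)
Lemma price_threshold N t m u : instances_given s N -> 0 < u < 1 ->
  (t < N m)%N -> price R B G (played (pu u) N t) m =
    1 * (1 - (u <= Phi N t.+1)%R%:R) + pass_price R B G (nactive N t) *
      ((u <= Phi N t.+1)%R%:R - (u <= Phi N t)%R%:R).
Proof.
move=> hN u01 tN; have /andP[u0 _] := u01; have [[N0 _] _] := hN.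
have [h|h] := boolP (u <= Phi N t).
  have h' : u <= Phi N t.+1 by rewrite (le_trans h) // law_homo.
  rewrite /price played_bought ?bought_threshold ?(ltnW tN) // h'.
  by rewrite subrr !mulr0 addr0.
have Ep k : (t < N k)%N -> played (pu u) N t k =
    Some (if u <= Phi N t.+1 then kind (state_before N t) else Rent).
  by move=> tk; apply: played_threshold => //; rewrite bought_threshold ?(negbTE h) ?(ltnW tk).
rewrite /price Ep //; case: (boolP (u <= Phi N t.+1)) => h' /=; last first.
  by rewrite subrr mulr0 addr0 subr0 mulr1.
rewrite subrr mulr0 add0r subr0 mulr1 /kind /pass_price.
have -> : (M - size (state_before N t))%N = nactive N t.
  by rewrite -[X in (X - _)%N](size_state_before N t) addKn.
case: ifP => // GkB; congr (_ / _%:R); apply: eq_card => k; rewrite !finset.in_set.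
apply/idP/idP => [/eqP Ek|tk].
  by apply: (@buyers_active _ (pu u)) => //; rewrite Ek.
rewrite Ep // h' /kind.
have -> : (M - size (state_before N t))%N = nactive N t.
  by rewrite -[X in (X - _)%N](size_state_before N t) addKn.
by rewrite GkB.
Qed.

Lemma agent_cost_threshold N m u : instances_given s N -> 0 < u < 1 ->
  agent_cost R B G m (pu u) N = \sum_(t < N m)
    (1 * (1 - (u <= Phi N t.+1)%R%:R) + pass_price R B G (nactive N t) *
      ((u <= Phi N t.+1)%R%:R - (u <= Phi N t)%R%:R)).
Proof.
move=> hN u01; rewrite agent_costE; apply: eq_bigr => t _.
exact: price_threshold.
Qed.

End Threshold.
End Laws.

(** * Realizing a purchase law *)

Section CountableOperations.
Context d (T : measurableType d).

Lemma bigcup_countType_measurable (I : countType) (F : I -> set T) :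
  (forall i, measurable (F i)) -> measurable (\bigcup_i F i).
Proof. by move=> mF; apply: countable_bigcupT_measurable => //; exact: countableP. Qed.

Lemma forall_countType_measurable (I : countType) (Q : I -> T -> Prop) :
  (forall i, measurable [set x | Q i x]) -> measurable [set x | forall i, Q i x].
Proof.
move=> mQ; rewrite (_ : [set x | _] = ~` \bigcup_i ~` [set x | Q i x]).
  by apply: measurableC; apply: bigcup_countType_measurable => i; exact: measurableC.
rewrite setC_bigcup; apply/seteqP; split=> [x h i _|x h i].
  by rewrite setCK; apply: h.
by have := h i Logic.I; rewrite setCK.
Qed.

Lemma exists_countType_measurable (I : countType) (Q : I -> T -> Prop) :
  (forall i, measurable [set x | Q i x]) -> measurable [set x | exists i, Q i x].
Proof.
move=> mQ; rewrite (_ : [set x | _] = \bigcup_i [set x | Q i x]).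
  exact: bigcup_countType_measurable.
by apply/seteqP; split=> x /= [i]; [exists i | move=> _ h; exists i].
Qed.

Lemma imply_measurable (A : Prop) (Q : T -> Prop) :
  measurable [set x | Q x] -> measurable [set x | A -> Q x].
Proof.
move=> mQ; have [a|na] := pselect A.
  rewrite (_ : [set x | _] = [set x | Q x]) //.
  by apply/seteqP; split=> x /= h //; apply: h.
by rewrite (_ : [set x | _] = setT) //; apply/seteqP; split=> x // _ /na.
Qed.

End CountableOperations.

Lemma mean_uniform (R : realType) (x : R) : 0 <= x <= 1 ->
  mean (uniform_prob (@ltr01 R)) (fun u => (u <= x)%R%:R) = x.
Proof.
move=> /andP[x0 x1]; rewrite /mean /Rintegral.
have -> : (fun u : R => (((u <= x)%R%:R : R)%:E)) = (fun u => (\1_(`]-oo, x]%classic) u)%:E).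
  by apply/funext => u; rewrite indicE mem_setE in_itv.
rewrite integral_indic // setIT /= /uniform_prob integral_uniform_pdf.
rewrite (_ : _ `&` _ = `[0, x]%classic); last first.
  apply/seteqP; split=> u /=; rewrite !in_itv /=.
    by move=> [ux /andP[u0 _]]; rewrite u0.
  by move=> /andP[u0 ux]; rewrite ux u0 (le_trans ux).
rewrite (eq_integral (fun=> 1%:E)); last first.
  move=> u; rewrite inE /= in_itv /= /uniform_pdf => /andP[u0 ux].
  by rewrite u0 (le_trans ux) //= subr0 invr1.
rewrite integral_cst //= lebesgue_measure_itv /= lte_fin mul1e.
case: ltP => [_|xle]; first by rewrite oppr0 adde0.
by apply/eqP; rewrite eq_le x0 xle.
Qed.

Section Realization.
Variables (R : realType) (M B G : nat) (s : seq nat).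
Hypotheses (G0 : (0 < G)%N) (B0 : (0 < B)%N) (M0 : (0 < M)%N).
Hypotheses (s_sorted : sorted leq s) (sM : (size s <= M)%N).
Implicit Types (N : 'I_M -> nat) (m : 'I_M) (t n d : nat).
Local Notation policies := (g_sigma_algebraType (@cylinders M)).
Local Notation U := (uniform_prob (@ltr01 R)).
Local Notation hist := (seq ({ffun 'I_M -> option move} * {set 'I_M})).

Let m0 : 'I_M := Ordinal M0.

(* Countably many cylinder conditions that force a policy to be symmetric and
   to rent until the state [s] is entered: unlike [symmetric], they define a
   measurable set. *)
Definition threshold_like (pi : policies) : Prop :=
  [/\ forall h : hist, forall m, pi h m = pi h m0,
      forall h : hist, pi h m0 <> Rent -> pi h m0 = kind M B G (history_state h),
      forall h h' : hist, history_state h = history_state h' ->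
        (size h <= size h')%N -> pi h m0 <> Rent -> pi h' m0 <> Rent,
      forall h : hist, exists h' : hist,
        history_state h = history_state h' /\ pi h' m0 <> Rent &
      forall h : hist, forall m, (size h < last 0%N s)%N -> pi h m = Rent].

Lemma measurable_move_pred (h : history M) m (Q : move -> Prop) :
  measurable ([set pi | Q (pi h m)] : set policies).
Proof.
rewrite (_ : [set pi | _] = \bigcup_(a : move) [set pi : policies | Q a /\ pi h m = a]).
  apply: bigcup_countType_measurable => a; have [q|nq] := pselect (Q a).
    rewrite (_ : [set pi | _] = [set pi : policies | pi h m = a]).
      exact: measurable_cylinder.
    by apply/seteqP; split=> pi /= => [[]|].
  by rewrite (_ : [set pi | _] = set0) //; apply/seteqP; split=> pi // [].
by apply/seteqP; split=> pi /= => [q|[a _ [q ->]]] //; exists (pi h m).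
Qed.

Lemma measurable_same_move (h : history M) m m' :
  measurable ([set pi | pi h m = pi h m'] : set policies).
Proof.
rewrite (_ : [set pi | _] = \bigcup_(a : move)
  ([set pi : policies | pi h m = a] `&` [set pi : policies | pi h m' = a])).
  by apply: bigcup_countType_measurable => a; apply: measurableI; exact: measurable_cylinder.
by apply/seteqP; split=> pi /= => [q|[a _ [/= -> ->]]] //; exists (pi h m).
Qed.

Lemma measurable_threshold_like : measurable ([set pi | threshold_like pi]).
Proof.
rewrite (_ : [set pi | _] =
  [set pi : policies | forall h : hist, forall m, pi h m = pi h m0] `&`
  [set pi : policies | forall h : hist, pi h m0 <> Rent ->
     pi h m0 = kind M B G (history_state h)] `&`
  [set pi : policies | forall h h' : hist, history_state h = history_state h' ->
        (size h <= size h')%N -> pi h m0 <> Rent -> pi h' m0 <> Rent] `&`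
  [set pi : policies | forall h : hist, exists h' : hist,
        history_state h = history_state h' /\ pi h' m0 <> Rent] `&`
  [set pi : policies | forall h : hist, forall m, (size h < last 0%N s)%N -> pi h m = Rent]);
    last first.
  by apply/seteqP; split=> pi /= => [[]|[[[[]]]]].
apply: measurableI; [apply: measurableI; [apply: measurableI; [apply: measurableI|]|]|].
- apply: forall_countType_measurable => h; apply: forall_countType_measurable => m.
  exact: measurable_same_move.
- apply: forall_countType_measurable => h.
  exact: (@measurable_move_pred h m0 (fun a => a <> Rent -> a = _)).
- apply: forall_countType_measurable => h; apply: forall_countType_measurable => h'.
  apply: imply_measurable; apply: imply_measurable.
  rewrite (_ : [set pi | _] = ~` [set pi : policies | pi h m0 <> Rent] `|`
    [set pi : policies | pi h' m0 <> Rent]).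
    apply: measurableU; first apply: measurableC.
      exact: (@measurable_move_pred h m0 (fun a => a <> Rent)).
    exact: (@measurable_move_pred h' m0 (fun a => a <> Rent)).
  apply/seteqP; split=> pi /= => [|[]] // h1.
  by have [|] := pselect (pi h m0 <> Rent); [right; auto | left].
- apply: forall_countType_measurable => h; apply: exists_countType_measurable => h'.
  have [e|ne] := pselect (history_state h = history_state h').
    rewrite (_ : [set pi | _] = [set pi : policies | pi h' m0 <> Rent]).
      exact: (@measurable_move_pred h' m0 (fun a => a <> Rent)).
    by apply/seteqP; split=> pi /= => [[]|].
  by rewrite (_ : [set pi | _] = set0) //; apply/seteqP; split=> pi // [].
- apply: forall_countType_measurable => h; apply: forall_countType_measurable => m.
  by apply: imply_measurable; exact: measurable_cylinder.
Qed.

Lemma threshold_like_reaches pi : threshold_like pi -> reaches s pi.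
Proof.
move=> [_ _ _ _ rent] N _ m.
suff h t : (t <= last 0%N s)%N -> ~~ bought (run pi N t) m by apply: h.
elim: t => // t IH ts; rewrite boughtS negb_or IH ?(ltnW ts) //=.
by rewrite /played ffunE; case: ifP => // _; rewrite rent ?size_run.
Qed.

Lemma threshold_like_symmetric pi : threshold_like pi -> Defs.symmetric pi.
Proof.
move=> [same kindE mono ex _].
pose buying sigma n := `[< exists h : hist,
  [/\ history_state h = sigma, size h = n & pi h m0 <> Rent] >].
(* The threshold is recovered from the shortest history with state [sigma] on which [pi] buys; a
   history of [n] days is followed by day [n + 1]. *)
pose T sigma := match pselect (exists n, buying sigma n) with
  | left e => (ex_minn e).+1 | right _ => 0%N end.
exists T, (kind M B G); split; first exact: kind_neq_Rent.
move=> N [N0 Nm] t m _; set h := run pi N t.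
have hs : history_state h = state_before N t by exact: history_state_run.
rewrite same -hs /T; case: pselect => [e|[]]; last first.
  have [h' [hh' bh']] := ex h; exists (size h'); apply/asboolP; exists h'.
  by split.
case: ex_minnP => n /asboolP[h' [hh' <- bh']] nmin.
rewrite ltnS; case: ltnP => tn.
  have [//|nr] := eqVneq (pi h m0) Rent.
  have : (size h' <= t)%N.
    by apply: nmin; apply/asboolP; exists h; split=> //; [exact: size_run | exact/eqP].
  by rewrite leqNgt tn.
by apply: kindE; apply: (mono h') => //; rewrite size_run.
Qed.

Variable Phi : ('I_M -> nat) -> nat -> R.
Local Notation pu := (threshold_policy B G s Phi).

Lemma threshold_policy_like u : 0 < u -> threshold_like (pu u).
Proof.
move=> u0; split=> //.
- by move=> h; rewrite /threshold_policy; case: ifP.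
- move=> h h' hh' sz; rewrite /threshold_policy hh'; case: ltnP => // tu _.
  rewrite ltnNge (leq_trans tu) //=; exact: kind_neq_Rent.
- move=> h; pose n := threshold s Phi u (history_state h).
  (* An idle day without departures lengthens the history without changing its state; enough of them
     pass any threshold. *)
  pose r : {ffun 'I_M -> option move} * {set 'I_M} := ([ffun=> None], finset.set0).
  exists (h ++ nseq n r).
  have E : history_state (h ++ nseq n r) = history_state h.
    rewrite /history_state (eq_filter (a2 := inactive h)); last first.
      move=> m; rewrite /inactive has_cat [X in _ || X](_ : _ = false) ?orbF //.
      by apply/hasP => -[x /nseqP[-> _]]; rewrite /= inE.
    apply/eq_in_map => m; rewrite mem_filter => /andP[im _].
    by rewrite find_cat; move: im; rewrite /inactive => ->.
  split=> //; rewrite /threshold_policy E size_cat size_nseq -/n.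
  rewrite ltnNge (_ : (n <= _)%N) /=; first exact: kind_neq_Rent.
  by rewrite ltnW // ltnS leq_addl.
- move=> h m hl; rewrite /threshold_policy ifT //.
  by rewrite (leq_ltn_trans hl) // threshold_gt.
Qed.

Lemma measurable_threshold (sigma : seq nat) n :
  measurable_fun setT (fun u : measurableTypeR R => (threshold s Phi u sigma <= n)%N).
Proof.
have mle (d : nat) :
    measurable ([set u | u <= state_law s Phi sigma d] : set (measurableTypeR R)).
  rewrite (_ : [set u | _] = `]-oo, state_law s Phi sigma d]%classic).
    exact: measurable_itv.
  by apply/seteqP; split=> u /=; rewrite in_itv.
apply: (@measurable_fun_bool _ _ _ _ true); rewrite setTI.
rewrite (_ : _ @^-1` _ =
  [set u : R | exists d : nat, ((d <= n)%N : Prop) /\ u <= state_law s Phi sigma d] `|`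
  ([set u : R | (last 0%N s < n)%N] `&`
   [set u : R | forall d : nat, ~ (u <= state_law s Phi sigma d)])).
  apply: measurableU; [apply: exists_countType_measurable => d | apply: measurableI].
  - have [h|h] := boolP (d <= n)%N.
      by rewrite (_ : [set u | _] = [set u : R | u <= state_law s Phi sigma d]) //;
         apply/seteqP; split=> u /= => [[]|].
    by rewrite (_ : [set u | _] = set0) //; apply/seteqP; split=> u // [].
  - case: (_ < n)%N.
      by rewrite (_ : [set u | _] = setT) //; apply/seteqP; split.
    by rewrite (_ : [set u | _] = set0) //; apply/seteqP; split.
  - by apply: forall_countType_measurable => d; exact: (measurableC (mle d)).
apply/seteqP; split=> u; rewrite /preimage /= /threshold; case: pselect => e.
- case: ex_minnP => d ud _ dn; left; exists d; by split.
- by move=> ln; right; split=> // d ud; apply: e; exists d.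
- case: ex_minnP => d _ dmin [[d' [d'n ud']]|[_ h]]; first exact: leq_trans (dmin _ ud') d'n.
  by case: e => d' /h.
- by move=> [[d [_ ud]]|[]] //; case: e; exists d.
Qed.

Lemma measurable_threshold_policy :
  measurable_fun setT (pu : measurableTypeR R -> policies).
Proof.
apply: (@measurability _ _ _ policies setT _ (@cylinders M)) => //.
move=> _ [_ [h [m [a ->]]] <-].
have := @measurable_threshold (history_state h) (size h).+1.
move=> /(_ measurableT [set b | (if b then kind M B G (history_state h) else Rent) = a]).
move=> /(_ Logic.I); congr (measurable _); rewrite !setTI.
apply/seteqP; split=> u /=; rewrite /threshold_policy /=; by case: ltnP.
Qed.

HB.instance Definition _ := @isMeasurableFun.Build _ _ _ _ (pu : measurableTypeR R -> policies)
  measurable_threshold_policy.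

Definition law_policy : randomized_policy R M :=
  distribution U (pu : {mfun measurableTypeR R >-> policies}).

(** Both endpoints are exceptional: [u = 0] buys before [s] is entered, and [u = 1] may never be
    reached by [Phi]. *)
Lemma uniform_open_ae : {ae U, forall u : R, 0 < u < 1}.
Proof.
have : U (~` `]0%R, 1%R[%classic) = 0%E.
  rewrite /= /uniform_prob integral_uniform_pdf; apply: null_set_integral.
  - by apply: measurableI => //; apply: measurableC.
  - by apply: measurable_funTS; apply/measurable_EFinP; exact: measurable_uniform_pdf.
  rewrite (_ : _ `&` _ = [set 0%R; 1%R]).
    rewrite measureU //=; last first.
      apply/seteqP; split=> x //= [-> /eqP]; by rewrite eq_sym oner_eq0.
    by rewrite !lebesgue_measure_set1 adde0.
  apply/seteqP; split=> x /=; rewrite !in_itv /=.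
    move=> [/negP]; rewrite negb_and -!leNgt => /orP[x0|x1] /andP[x0' x1'].
      by left; apply/eqP; rewrite eq_le x0 x0'.
    by right; apply/eqP; rewrite eq_le x1 x1'.
  by move=> [->|->]; rewrite ?ltxx ?lexx ?ler01 ?andbF.
move=> U0; exists (~` `]0%R, 1%R[%classic); split=> //.
  by apply: measurableC; exact: measurable_itv.
Qed.

Lemma law_policy_ae : {ae law_policy, forall pi, threshold_like pi}.
Proof.
exists (~` [set pi | threshold_like pi]); split=> //.
  by apply: measurableC; exact: measurable_threshold_like.
have [A [mA A0 hA]] := uniform_open_ae.
apply/eqP; rewrite eq_le measure_ge0 andbT -A0.
rewrite /law_policy /distribution /pushforward; apply: (@le_measure _ _ _ U); rewrite ?inE //.
  rewrite -[X in measurable X]setTI; apply: measurable_threshold_policy => //.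
  by apply: measurableC; exact: measurable_threshold_like.
move=> u /= nl; apply: hA => /= /andP[u0 _]; apply: nl.
exact: threshold_policy_like.
Qed.

Hypotheses (hPhi : purchase_law s Phi) (hE : eventually_bought s Phi).

Lemma law_policy_cost N m : instances_given s N ->
  mean law_policy (fun pi => agent_cost R B G m pi N) = law_cost B G Phi m N.
Proof.
move=> hN; have hb := bounded_measurable_agent_cost R B G N m.
have mle (x : R) : bounded_measurable (fun u : measurableTypeR R => (u <= x)%R%:R : R).
  split; last by exists 1 => u; case: (u <= x); rewrite ?normr1 ?normr0.
  rewrite (_ : (fun u => _) = \1_(`]-oo, x]%classic)).
    by apply: measurable_indic.
  by apply/funext => u; rewrite indicE mem_setE in_itv.
have -> : mean law_policy (fun pi => agent_cost R B G m pi N) =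
    mean U (fun u => agent_cost R B G m (pu u) N).
  rewrite /mean /Rintegral; congr fine; rewrite ge0_integral_distribution //.
    by apply/measurable_EFinP; case: hb.
  by move=> pi; rewrite lee_fin; apply: sumr_ge0 => t _; apply: price_ge0.
pose hcost (u : measurableTypeR R) := \sum_(t < N m)
    (1 * (1 - (u <= Phi N t.+1)%R%:R) + pass_price R B G (nactive N t) *
      ((u <= Phi N t.+1)%R%:R - (u <= Phi N t)%R%:R)) : R.
have hb' : bounded_measurable hcost.
  exact: (bounded_measurable_stage _ (fun=> 1) _ (fun i => mle _) (fun i => mle _)).
rewrite (@ae_eq_mean _ _ _ _ _ hcost) //.
- rewrite /hcost (mean_stage _ _ (fun=> 1) _ (fun i => mle _) (fun i => mle _)).
  by apply: eq_bigr => t _; rewrite !mean_uniform //; exact: (law_bounds hPhi).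
- have [mb [C hC]] := hb; split; last by exists C => u; apply: hC.
  exact: (measurableT_comp mb measurable_threshold_policy).
- have [A [mA A0 hA]] := uniform_open_ae.
  exists A; split=> // u /= nu; apply: hA => /= u01; apply: nu.
  by apply: agent_cost_threshold.
Qed.

End Realization.

(** * Existence of a minimizer *)

Lemma ultra_fmap (T V : Type) (f : T -> V) (F : set_system T) :
  UltraFilter F -> UltraFilter (f @ F).
Proof.
move=> FU; split=> [|E EP sFE].
  by apply: fmap_proper_filter; exact: ultra_proper.
apply/seteqP; split=> [A EA|]; last exact: sFE.
case: (in_ultra_setVsetC (f @^-1` A) FU) => // nA.
have EnA : E (~` A) by apply: sFE.
by have [x []] := filter_ex (filterI EA EnA).
Qed.

(** One ultrafilter gives limits for all [N] and [d] simultaneously, without a diagonal extraction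
    of subsequences. *)
Lemma ultra_cvg_bounded (R : realType) (F : set_system nat) (u : nat -> R) :
  UltraFilter F -> (forall n, 0 <= u n <= 1) -> u @ F --> lim (u @ F).
Proof.
move=> FU u01; have := @segment_compact R 0 1; rewrite compact_ultra.
move=> /(_ (u @ F) (ultra_fmap u FU)) [].
  by apply: (@filterE _ F) => n; rewrite /= in_itv /=; exact: u01.
by move=> l [_ /= ul]; apply/cvg_ex; exists l.
Qed.

Lemma nth_state_le_last (M : nat) (s : seq nat) i : is_state M s ->
  (i < size s)%N -> (nth 0%N s i <= last 0%N s)%N.
Proof.
move=> [_ _ ss] il; rewrite -nth_last.
by apply: (sorted_leq_nth leq_trans leqnn) => //; rewrite ?inE; lia.
Qed.

Section Minimization.
Variables (R : realType) (M B G : nat) (s : seq nat).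
Hypotheses (G0 : (0 < G)%N) (B0 : (0 < B)%N) (M0 : (0 < M)%N).
Hypothesis hs : is_state M s.
Implicit Types (N : 'I_M -> nat) (m : 'I_M) (t n d : nat).
Implicit Types (Phi : ('I_M -> nat) -> nat -> R).
Local Notation policies := (g_sigma_algebraType (@cylinders M)).

Variables (Q : pred 'I_M) (cost : policy M -> ('I_M -> nat) -> R).
Variable (opt : ('I_M -> nat) -> R).

Definition laws_cost Phi N : R := \sum_(m | Q m) law_cost B G Phi m N.

(* Once no agent counted in the cost is active, buying is free. *)
Definition buys_when_free Phi := forall N d, instances_given s N ->
  (last 0%N s < d)%N -> (exists m, d <= N m)%N -> (forall m, Q m -> N m < d)%N ->
  Phi N d = 1.

Lemma extend_instance N d d' : instances_given s N -> (last 0%N s < d <= d')%N ->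
  instances_given s (extend N d d').
Proof.
move=> [[N0 Nm] Ns] /andP[ld dd']; split; [split|].
- by move=> m; rewrite /extend; case: ifP => // _; lia.
- move=> m n /Nm h; rewrite /extend.
  by case: (ltnP (N m) d) => h1; case: (ltnP (N n) d) => h2; lia.
- move=> m ms; rewrite /extend Ns // ifT //.
  exact: leq_ltn_trans (nth_state_le_last hs ms) ld.
Qed.

Lemma law_cost_ge Phi N m : purchase_law s Phi -> instances_given s N ->
  (N m)%:R * (1 - Phi N (N m)) <= law_cost B G Phi m N.
Proof.
move=> hP hN; have -> : (N m)%:R * (1 - Phi N (N m)) = \sum_(t < N m) (1 - Phi N (N m)).
  by rewrite sumr_const card_ord mulr_natl.
apply: ler_sum => t _; rewrite mul1r -[X in X <= _]addr0; apply: lerD.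
  by rewrite lerD2l lerN2 (law_homo_leq hP).
by rewrite mulr_ge0 ?pass_price_ge0 // subr_ge0 (law_homo hP).
Qed.

Lemma law_cost_ge0 Phi N m : purchase_law s Phi -> instances_given s N ->
  0 <= law_cost B G Phi m N.
Proof.
move=> hP hN; apply: le_trans (law_cost_ge m hP hN); rewrite mulr_ge0 // subr_ge0.
by case/andP: (law_bounds hP (N m) hN).
Qed.

(** If [Phi] stayed below [u] on all extensions, a counted agent that stays until [d'] would pay at
    least [d' * (1 - u)] in rent, which exceeds [C] for large [d']. *)
Lemma bounded_cost_eventually Phi (C : R) : purchase_law s Phi -> buys_when_free Phi ->
  (forall N, instances_given s N -> laws_cost Phi N <= C) -> eventually_bought s Phi.
Proof.
move=> hP hF hC N d u hN ld [m1 dm1] u1.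
have [[m [Qm dm]]|noQ] := pselect (exists m, Q m /\ (d <= N m)%N); last first.
  exists d; rewrite (@law_adapted _ _ _ _ hP _ N) => [|m]; last first.
    rewrite /extend; case: ifP => // /negbT; rewrite -leqNgt => h.
    by rewrite minnn (minn_idPr h).
  rewrite hF ?ltW //; first by exists m1.
  by move=> m Qm; rewrite ltnNge; apply/negP => dm; apply: noQ; exists m.
apply: contrapT => nE.
have lt_u d' : Phi (extend N d d') d' < u.
  by rewrite ltNge; apply/negP => h; apply: nE; exists d'.
pose d' := (d + Num.bound (C / (1 - u)))%N.
have hN' : instances_given s (extend N d d').
  by apply: extend_instance => //; rewrite ld leq_addr.
have u1' : 0 < 1 - u by rewrite subr_gt0.
have Em : extend N d d' m = d' by rewrite /extend ltnNge dm.
have : d'%:R * (1 - u) <= C.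
  apply: le_trans (hC _ hN'); rewrite /laws_cost (bigD1 m) //= -[X in X <= _]addr0.
  apply: lerD; last by apply: sumr_ge0 => i _; apply: law_cost_ge0.
  apply: le_trans (law_cost_ge m hP hN'); rewrite Em ler_wpM2l //.
  by rewrite lerD2l lerN2 ltW.
rewrite -ler_pdivlMr // => h.
have C0 : 0 <= C.
  apply: le_trans (hC _ hN); apply: sumr_ge0 => i _; exact: law_cost_ge0.
have : C / (1 - u) < d'%:R.
  apply: lt_le_trans (archi_boundP _) _; first by rewrite divr_ge0 ?(ltW u1').
  by rewrite ler_nat leq_addl.
by rewrite ltNge h.
Qed.

Hypothesis costE : forall pi N, cost pi N = \sum_(m | Q m) agent_cost R B G m pi N.
Hypothesis opt_gt0 : forall N, instances_given s N -> 0 < opt N.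
Hypothesis opt_bounded : exists C, forall N, instances_given s N -> opt N <= C.
(** Only the guarantee [c] has to be preserved; on a single instance the new law may cost more than
    [g]. *)
Hypothesis imitation : forall (g : randomized_policy R M) (c : R), 0 <= c ->
  {ae g, forall pi, reaches s pi} ->
  (forall N, instances_given s N -> mean g (fun pi => cost pi N) <= c * opt N) ->
  exists Phi, [/\ purchase_law s Phi, buys_when_free Phi &
    forall N, instances_given s N -> laws_cost Phi N <= c * opt N].

Lemma bounded_measurable_cost N : bounded_measurable (fun pi : policies => cost pi N).
Proof.
apply: (@eq_bounded_measurable _ policies R _ _ (fun pi => esym (costE pi N))).
by apply: bounded_measurable_sum => m _; exact: bounded_measurable_agent_cost.
Qed.

Lemma expected_costE (g : randomized_policy R M) N :
  expected_cost cost g N = (mean g (fun pi => cost pi N))%:E.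
Proof. by rewrite /expected_cost meanE //; exact: bounded_measurable_cost. Qed.

Lemma CR_le (g : randomized_policy R M) (c : R) :
  (CR cost opt s g <= c%:E)%E <->
  (forall N, instances_given s N -> mean g (fun pi => cost pi N) <= c * opt N).
Proof.
have E N : instances_given s N ->
    (expected_cost cost g N * ((opt N)^-1)%:E <= c%:E)%E =
    (mean g (fun pi => cost pi N) <= c * opt N).
  move=> hN; rewrite expected_costE -EFinM lee_fin ler_pdivrMr //; exact: opt_gt0.
split=> [h N hN|h].
  rewrite -E //; apply: le_trans h; apply: ereal_sup_ubound; by exists N.
by apply: ge_ereal_sup => _ [N hN <-]; rewrite E // h.
Qed.

Lemma limit_law (c : R) (Phis : nat -> ('I_M -> nat) -> nat -> R) :
  (forall n, purchase_law s (Phis n)) -> (forall n, buys_when_free (Phis n)) ->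
  (forall n N, instances_given s N ->
     laws_cost (Phis n) N <= (c + n.+1%:R^-1) * opt N) ->
  exists Phi, [/\ purchase_law s Phi, buys_when_free Phi &
    forall N, instances_given s N -> laws_cost Phi N <= c * opt N].
Proof.
move=> hP hF hC.
have [F [FU sF]] := @ultraFilterLemma nat \oo eventually_filter.
have FF : ProperFilter F by exact: ultra_proper.
pose Phi N d := lim ((fun n => Phis n N d) @ F).
have cvgPhi N d : instances_given s N -> (fun n => Phis n N d) @ F --> Phi N d.
  by move=> hN; apply: ultra_cvg_bounded => n; exact: (law_bounds (hP n) d hN).
have lim_eq N d (x : R) : (forall n, Phis n N d = x) -> Phi N d = x.
  move=> h; rewrite /Phi (_ : (fun n => _) = fun=> x); last exact/funext.
  exact: lim_cst.
exists Phi; split; [split|..].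
(* Adaptedness concerns all [N], including those for which no limit is known to exist; equal
   sequences suffice. *)
- move=> N N' d NN'; rewrite /Phi.
  rewrite (_ : (fun n => Phis n N d) = (fun n => Phis n N' d)) //; apply/funext => n.
  exact: (law_adapted (hP n)).
- move=> N d hN; apply/andP; split.
    apply: (limr_ge (cvgP _ (cvgPhi _ _ hN))); apply: nearW => n.
    by case/andP: (law_bounds (hP n) d hN).
  apply: (limr_le (cvgP _ (cvgPhi _ _ hN))); apply: nearW => n.
  by case/andP: (law_bounds (hP n) d hN).
- move=> N d hN; apply: (ler_cvg_to (cvgPhi N d hN) (cvgPhi N d.+1 hN)).
  by apply: nearW => n; exact: (law_homo (hP n)).
- by move=> N d hN dl; apply: lim_eq => n; exact: (law_zero (hP n)).
- by move=> N d hN ld ex all; apply: lim_eq => n; exact: hF.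
move=> N hN.
have cL : (fun n => laws_cost (Phis n) N) @ F --> laws_cost Phi N.
  rewrite /laws_cost /law_cost; apply: cvg_big => [|m _]; first exact: add_continuous.
  apply: cvg_big => [|t _]; first exact: add_continuous.
  apply: cvgD; apply: cvgM; try exact: cvg_cst.
    by apply: cvgB; [exact: cvg_cst | exact: cvgPhi].
  by apply: cvgB; exact: cvgPhi.
have cR : (fun n => (c + n.+1%:R^-1) * opt N) @ F --> c * opt N.
  apply: cvgM; last exact: cvg_cst.
  rewrite -[X in _ --> X]addr0; apply: cvgD; first exact: cvg_cst.
  apply: cvg_trans (@cvg_harmonic R); exact: cvg_app.
by apply: (ler_cvg_to cL cR); apply: nearW => n; exact: hC.
Qed.

Let sM : (size s <= M)%N. Proof. by case: hs => /ltnW. Qed.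
Let s_sorted : sorted leq s. Proof. by case: hs. Qed.

Lemma law_policy_correct Phi : purchase_law s Phi -> eventually_bought s Phi ->
  [/\ {ae law_policy B G s Phi, forall pi, reaches s pi},
      {ae law_policy B G s Phi, forall pi, Defs.symmetric pi} &
      forall N, instances_given s N ->
        mean (law_policy B G s Phi) (fun pi => cost pi N) = laws_cost Phi N].
Proof.
move=> hP hE; have [A [mA A0 hA]] := @law_policy_ae R M B G s M0 Phi.
split.
- exists A; split=> // pi /= np; apply: hA => /= /threshold_like_reaches; exact: np.
- exists A; split=> // pi /= np; apply: hA => /= /threshold_like_symmetric; exact: np.
move=> N hN; rewrite /laws_cost.
rewrite (_ : (fun pi => cost pi N) =
  fun pi : policies => \sum_(m | Q m) agent_cost R B G m pi N); last first.
  by apply/funext => pi; exact: costE.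
rewrite mean_sum => [|m _]; last exact: bounded_measurable_agent_cost.
by apply: eq_bigr => m _; rewrite law_policy_cost.
Qed.

Lemma CR_minimized : minimized_by_symmetric s (CR cost opt s).
Proof.
pose V := [set CR cost opt s g | g in
    [set g : randomized_policy R M | {ae g, forall pi, reaches s pi}]].
have V_lb (g : randomized_policy R M) : {ae g, forall pi, reaches s pi} ->
    (ereal_inf V <= CR cost opt s g)%E.
  by move=> hg; apply: ereal_inf_lbound; exists g.
suff [f [hr hsym hf]] : exists f : randomized_policy R M, [/\ {ae f, forall pi, reaches s pi},
    {ae f, forall pi, Defs.symmetric pi} & (CR cost opt s f <= ereal_inf V)%E].
  by exists f; split=> // g hg; apply: le_trans hf (V_lb g hg).
have [l0 ls] : (size s < M)%N /\ all (fun n => 0 < n)%N s by case: hs.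
have ex : exists N, instances_given s N.
  exists (fun m => nth (last 0%N s).+1 s m); split; last first.
    by move=> m ms; exact: set_nth_default.
  split=> [m|m n mn].
    case: (ltnP m (size s)) => h; last by rewrite nth_default.
    by rewrite (all_nthP _ ls).
  case: (ltnP n (size s)) => hn; last first.
    rewrite [X in (_ <= X)%N]nth_default //.
    case: (ltnP m (size s)) => hm; last by rewrite nth_default.
    rewrite (set_nth_default 0%N) //; exact: leqW (nth_state_le_last hs hm).
  by apply: (sorted_leq_nth leq_trans leqnn) => //; rewrite ?inE ?(leq_ltn_trans mn).
have [N1 hN1] := ex.
have V_ge0 : (0 <= ereal_inf V)%E.
  apply: le_ereal_inf_tmp => _ [g _ <-]; apply: le_trans (ereal_sup_ubound _); last by exists N1.
  rewrite mule_ge0 ?lee_fin ?invr_ge0 ?(ltW (opt_gt0 hN1)) // /expected_cost.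
  apply: integral_ge0 => pi _; rewrite lee_fin costE; apply: sumr_ge0 => m _.
  by apply: sumr_ge0 => t _; exact: price_ge0.
case Ec : (ereal_inf V) V_ge0 => [c| |] // c0; last first.
  (* If the infimum is infinite, any symmetric policy attains it; here everybody buys on the first
     day of [s]. *)
  pose Phi0 (N : 'I_M -> nat) d : R := ((last 0%N s < d)%N)%:R.
  have hP : purchase_law s Phi0.
    split=> //.
    - by move=> N d _; rewrite /Phi0; case: (_ < d)%N; rewrite ?ler01 ?lexx.
    - by move=> N d _; rewrite /Phi0 ler_nat; have [h|//] := ltnP (last 0%N s) d; rewrite leqW.
    - by move=> N d _; rewrite /Phi0 leqNgt => /negbTE ->.
  have hE : eventually_bought s Phi0.
    by move=> N d u _ ld _ u1; exists d; rewrite /Phi0 ld ltW.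
  have [h1 h2 _] := law_policy_correct hP hE.
  by exists (law_policy B G s Phi0); split=> //; rewrite leey.
have near_opt n : exists Phi, [/\ purchase_law s Phi, buys_when_free Phi &
    forall N, instances_given s N -> laws_cost Phi N <= (c + n.+1%:R^-1) * opt N].
  have n0 : 0 < n.+1%:R^-1 :> R by rewrite invr_gt0.
  have : (ereal_inf V < (c + n.+1%:R^-1)%:E)%E by rewrite Ec lte_fin ltrDl.
  move=> /ereal_inf_lt[_ [g hg <-] hlt].
  apply: (imitation _ hg); first by rewrite addr_ge0 ?(ltW n0).
  by apply/CR_le; exact: ltW.
have [Phis hPhis] := choice near_opt.
have [|||Phi [hP hF hC]] := @limit_law c Phis; try by move=> n; case: (hPhis n).
have [C hoC] := opt_bounded.
have hE : eventually_bought s Phi.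
  apply: (@bounded_cost_eventually _ (c * C)) => // N hN.
  by apply: le_trans (hC N hN) _; rewrite ler_wpM2l // hoC.
have [h1 h2 h3] := law_policy_correct hP hE.
exists (law_policy B G s Phi); split=> //; apply/CR_le => N hN.
by rewrite h3 // hC.
Qed.

End Minimization.

(** * Imitation: one agent, or few active agents *)

Section Agreement.
Variable M : nat.
Implicit Types (pi : policy M) (N : 'I_M -> nat) (m : 'I_M) (t n d : nat).

Lemma agree_le N N' d d' : (d' <= d)%N -> agree N N' d -> agree N N' d'.
Proof.
move=> dd' h m; have := h m.
by case: (leqP (N m) d) => h1; case: (leqP (N' m) d) => h2; lia.
Qed.

Lemma agree_bought pi N N' d m : agree N N' d ->
  bought (run pi N d) m = bought (run pi N' d) m.
Proof. by case: d => // d h; rewrite !boughtS /played (eq_run pi h). Qed.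

Lemma agree_nbought pi N N' d : agree N N' d -> nbought pi N d = nbought pi N' d.
Proof.
move=> h; apply: eq_card => m; rewrite !finset.in_set; exact: agree_bought.
Qed.

Lemma agree_nactive N N' d t : agree N N' d -> (t < d)%N -> nactive N t = nactive N' t.
Proof.
move=> h td; apply: eq_card => m; rewrite !finset.in_set; have := h m.
by case: (leqP (N m) d) => h1; case: (leqP (N' m) d) => h2; lia.
Qed.

Lemma bought_while_active pi N d n m : (forall m, 0 < N m)%N ->
  bought (run pi N d) m -> (N m <= n)%N -> bought (run pi N n) m.
Proof.
move=> N0; elim: d => // d IH; rewrite boughtS => /orP[/IH //|bd] Nn.
apply: (@bought_homo _ pi N m d.+1); last by rewrite boughtS bd orbT.
exact: leq_trans (buyers_active N0 bd) Nn.
Qed.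

Lemma sum_ord_split (R : zmodType) (f : nat -> R) n tau :
  \sum_(t < n) f t = \sum_(t < tau | (t < n)%N) f t + \sum_(i < n - tau) f (tau + i)%N.
Proof.
rewrite -(big_mkord (fun t => t < n)%N f) -(big_mkord predT f).
rewrite -(big_mkord predT (fun i => f (tau + i)%N)).
have [h|h] := leqP n tau.
  have -> : (n - tau = 0)%N by lia.
  rewrite [X in _ + X]big_geq // addr0 (big_cat_nat (leq0n _) h) /=.
  rewrite [X in _ = _ + X]big_nat_cond [X in _ = _ + X]big1 ?addr0; last by move=> i; lia.
  by rewrite [LHS]big_nat_cond [RHS]big_nat_cond; apply: eq_bigl => i; lia.
rewrite (big_cat_nat (leq0n tau) (ltnW h)) /=; congr (_ + _).
  by rewrite [LHS]big_nat_cond [RHS]big_nat_cond; apply: eq_bigl => i; lia.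
by rewrite -{1}[tau]add0n big_addn; apply: eq_bigr => i _; rewrite addnC.
Qed.

Lemma sum_active (R : pzRingType) N (f : nat -> R) tau :
  \sum_(m < M) \sum_(t < tau | (t < N m)%N) f t = \sum_(t < tau) (nactive N t)%:R * f t.
Proof.
rewrite (exchange_big_dep predT) //=; apply: eq_bigr => t _.
rewrite sumr_const mulr_natl; congr (_ *+ _).
by apply: eq_card => m; rewrite finset.in_set.
Qed.

End Agreement.

Section Imitation.
Variables (R : realType) (M B G : nat) (s : seq nat).
Hypotheses (G0 : (0 < G)%N) (B0 : (0 < B)%N) (M0 : (0 < M)%N).
Hypothesis hs : is_state M s.
Implicit Types (N : 'I_M -> nat) (m : 'I_M) (t n d : nat).
Local Notation policies := (g_sigma_algebraType (@cylinders M)).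
Variables (g : randomized_policy R M).
Hypothesis g_reaches : {ae g, forall pi, reaches s pi}.

Lemma last_le_active N m : instances_given s N -> (size s <= m)%N ->
  (last 0%N s <= N m)%N.
Proof.
move=> [[_ Nm] Ns] sm; case: (lastP s) sm Ns => // s' x.
rewrite last_rcons size_rcons => sm Ns.
pose m' := Ordinal (ltn_trans sm (ltn_ord m)).
have := Ns m' (ltnSn _); rewrite /= nth_rcons ltnn eqxx => <-.
by apply: Nm; rewrite /= ltnW.
Qed.

Lemma le_last_inactive N m : instances_given s N -> (m < size s)%N ->
  (N m <= last 0%N s)%N.
Proof. by move=> [_ Ns] ms; rewrite Ns // (nth_state_le_last hs). Qed.

Lemma not_bought_before N pi t m : reaches s pi -> instances_given s N ->
  (t <= last 0%N s)%N -> bought (run pi N t) m = false.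
Proof.
move=> hr hN tl; apply/negbTE; apply: contra (hr N hN m); exact: bought_homo.
Qed.

Lemma sum_before N : \sum_(m < M) minn (N m) (last 0%N s) =
  (\sum_(t < last 0%N s) nactive N t)%N.
Proof.
under [RHS]eq_bigr do rewrite /nactive -sum1_card.
rewrite (exchange_big_dep predT) //=; apply: eq_bigr => m _.
rewrite (eq_bigl (fun t : 'I_(last 0%N s) => t < N m)%N); last first.
  by move=> t; rewrite finset.in_set.
rewrite -(big_mkord (fun t => t < N m)%N (fun=> 1%N)) big_nat_cond.
rewrite (eq_bigl (fun t => t < minn (N m) (last 0%N s))%N); last by move=> t; rewrite leq_min; lia.
have hmin : (minn (N m) (last 0%N s) <= last 0%N s)%N by rewrite geq_minr.
rewrite (big_cat_nat (leq0n _) hmin) /= [X in (_ + X)%N]big_nat_cond [X in (_ + X)%N]big1.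
  rewrite big_nat_cond (eq_bigl (fun t => (0 <= t < minn (N m) (last 0%N s)) && true)%N).
    by rewrite -big_nat_cond sum_nat_const_nat subn0 muln1 addn0.
  by move=> t; rewrite andbT /= andbb.
by move=> t; lia.
Qed.

Lemma mean_bought0 N t m : instances_given s N -> (t <= last 0%N s)%N ->
  mean g (fun pi => (bought (run pi N t) m)%:R) = 0.
Proof.
move=> hN tl; rewrite -(mean_cst g 0); apply: ae_eq_mean.
- exact: bounded_measurable_bought.
- exact: bounded_measurable_cst.
- by apply: (ae_mono _ g_reaches) => pi hr; rewrite (not_bought_before _ hr).
Qed.

(** * The individual ratio *)

Section Individual.
Variable m : 'I_M.

Definition agent_law N d : R :=
  if (d <= last 0%N s)%N then 0 else if (N m < d)%N then 1 else
  mean g (fun pi => (bought (run pi N d) m)%:R).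

Let mean01 N d : 0 <= mean g (fun pi => (bought (run pi N d) m)%:R) <= 1.
Proof.
apply: mean_bounds; first exact: bounded_measurable_bought.
by move=> pi; case: bought; rewrite ?ler01 ?lexx.
Qed.

Lemma agent_law_purchase : purchase_law s agent_law.
Proof.
split.
- move=> N N' d NN'; rewrite /agent_law.
  have -> : (N m < d)%N = (N' m < d)%N.
    by have := NN' m; case: (leqP (N m) d) => h1; case: (leqP (N' m) d) => h2; lia.
  case: ifP => // _; case: ifP => // _; congr mean.
  by apply/funext => pi; rewrite (agree_bought pi m NN').
- move=> N d _; rewrite /agent_law; case: ifP => _; first by rewrite lexx ler01.
  by case: ifP => _; [rewrite ler01 lexx | exact: mean01].
- move=> N d _; rewrite /agent_law.
  have [h1|h1] := leqP d (last 0%N s).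
    by case: ifP => _ //; case: ifP => _; rewrite ?ler01 //; case/andP: (mean01 N d.+1).
  have -> : (d.+1 <= last 0%N s)%N = false by lia.
  have [h2|h2] := ltnP (N m) d; first by rewrite ltnS (ltnW h2).
  case: ifP => _; first by case/andP: (mean01 N d).
  apply: mean_le; try exact: bounded_measurable_bought.
  move=> pi; rewrite ler_nat; case: (boolP (bought _ m)) => // b.
  by rewrite (bought_homo (leqnSn d) b).
- by move=> N d _ dl; rewrite /agent_law dl.
Qed.

Lemma agent_imitation (c : R) (opt : ('I_M -> nat) -> R) :
  (forall N, instances_given s N ->
     mean g (fun pi => agent_cost R B G m pi N) <= c * opt N) ->
  exists Phi, [/\ purchase_law s Phi, buys_when_free s (pred1 m) Phi &
    forall N, instances_given s N -> laws_cost B G (pred1 m) Phi N <= c * opt N].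
Proof.
move=> hg; exists agent_law; split; first exact: agent_law_purchase.
  move=> N d hN ld _ /(_ m (eqxx m)) h; by rewrite /agent_law leqNgt ld /= h.
move=> N hN; apply: le_trans (hg N hN); have [[N0 _] _] := hN.
rewrite /laws_cost big_pred1_eq /law_cost.
pose b t pi : R := (bought (run pi N t) m)%:R.
have Eb t : (t <= N m)%N -> agent_law N t = mean g (b t).
  move=> tN; rewrite /agent_law ltnNge tN /=; case: ifP => // tl.
  by rewrite mean_bought0.
have mb t : @bounded_measurable _ policies R (b t) by exact: bounded_measurable_bought.
rewrite (eq_bigr (fun t : 'I_(N m) => 1 * (1 - mean g (b t.+1)) +
    pass_price R B G (nactive N t) * (mean g (b t.+1) - mean g (b t)))); last first.
  by move=> t _; rewrite !Eb // ltnW.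
rewrite -(mean_stage _ _ (fun=> 1) _ (fun i : 'I_(N m) => mb i) (fun i => mb i.+1)).
apply: mean_le; last move=> pi.
- exact: (bounded_measurable_stage _ (fun=> 1) _ (fun i : 'I_(N m) => mb i) (fun i => mb i.+1)).
- exact: bounded_measurable_agent_cost.
rewrite agent_costE; apply: ler_sum => t _; rewrite mul1r; exact: day_cost_agent.
Qed.

End Individual.

(* Both overall benchmarks have the form [A0 + min (G, A1 + sum_m min (N_m, B))],
   the sum being over the agents that are active in the state [s]. *)
Definition overall_opt (A0 A1 : nat) N : nat :=
  (A0 + minn G (A1 + \sum_(m < M | size s <= m) minn (N m) B))%N.

(** Costs are grouped by day up to [tau], where all active agents are treated together, and by agent
    afterwards, where Jensen's inequality handles the different departures. *)
Lemma laws_cost_split Phi N tau :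
  laws_cost B G predT Phi N =
  \sum_(t < tau) ((nactive N t)%:R * (1 - Phi N t.+1) +
     (nactive N t)%:R * pass_price R B G (nactive N t) * (Phi N t.+1 - Phi N t)) +
  \sum_(m < M) \sum_(i < N m - tau) (1 * (1 - Phi N (tau + i).+1) +
     pass_price R B G (nactive N (tau + i)) * (Phi N (tau + i).+1 - Phi N (tau + i)%N)).
Proof.
rewrite /laws_cost /law_cost.
pose f t := 1 * (1 - Phi N t.+1) +
  pass_price R B G (nactive N t) * (Phi N t.+1 - Phi N t).
rewrite (eq_bigr (fun m => \sum_(t < tau | (t < N m)%N) f t +
   \sum_(i < N m - tau) f (tau + i)%N)); last by move=> m _; exact: sum_ord_split.
rewrite big_split /=; congr (_ + _); rewrite sum_active.
by apply: eq_bigr => t _; rewrite /f mul1r mulrDr mulrA.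
Qed.

(** * Overall ratios when few agents are active in the state *)

Section FewActive.
Variables (A0 A1 : nat) (c : R).
Let k := (M - size s)%N.
Hypotheses (kBG : (k * B < G)%N) (GMB : (G < M * B)%N) (c0 : 0 <= c).
Hypothesis hg : forall N, instances_given s N ->
  mean g (fun pi => total_cost R B G pi N) <= c * (overall_opt A0 A1 N)%:R.

Let k0 : (0 < k)%N. Proof. by case: hs; rewrite /k; lia. Qed.
Let k0' : 0 < k%:R :> R. Proof. by rewrite ltr0n. Qed.

(* all the agents active in the state [s] stay active until day [d] *)
Definition stay d : 'I_M -> nat := fun m => nth d s m.

Lemma stay_instance d : (0 < d)%N -> (last 0%N s <= d)%N -> instances_given s (stay d).
Proof.
move=> d0 ld; have [sM s0 ss] := hs.
split; [split|].
- move=> m; rewrite /stay; case: (ltnP m (size s)) => h; last by rewrite nth_default.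
  by rewrite (all_nthP _ s0).
- move=> m n mn; rewrite /stay; case: (ltnP n (size s)) => hn; last first.
    rewrite [X in (_ <= X)%N]nth_default //.
    case: (ltnP m (size s)) => hm; last by rewrite nth_default.
    by rewrite (set_nth_default 0%N) // (leq_trans (nth_state_le_last hs hm)).
  by apply: (sorted_leq_nth leq_trans leqnn) => //; rewrite ?inE ?(leq_ltn_trans mn).
- by move=> m ms; exact: set_nth_default.
Qed.

Lemma stay_agree d d' : (d <= d')%N -> agree (stay d) (stay d') d.
Proof.
move=> dd' m; rewrite /stay; case: (ltnP m (size s)) => h.
  by rewrite (set_nth_default d').
by rewrite !nth_default //; lia.
Qed.

Lemma card_active : #|[pred m : 'I_M | (size s <= m)%N]| = k.
Proof.
rewrite -sum1_card (eq_bigl (fun m : 'I_M => size s <= m)%N) //.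
rewrite -(big_mkord (fun i => size s <= i)%N (fun=> 1%N)).
have sM : (size s <= M)%N by case: hs => /ltnW.
rewrite (big_cat_nat (leq0n _) sM) /= big_nat_cond big1 ?add0n; last by move=> i; lia.
rewrite big_nat_cond (eq_bigl (fun i => (size s <= i < M) && true)%N); last by move=> i; lia.
by rewrite -big_nat_cond sum_nat_const_nat muln1.
Qed.

Lemma nactive_after N t : instances_given s N -> (last 0%N s <= t)%N ->
  (nactive N t <= k)%N.
Proof.
move=> hN lt; rewrite -card_active; apply/subset_leq_card/fintype.subsetP => m.
rewrite finset.in_set inE => tN; rewrite leqNgt; apply/negP => ms.
by have := le_last_inactive hN ms; lia.
Qed.

Lemma nactive_stay d t : instances_given s (stay d) -> (last 0%N s <= t < d)%N ->
  nactive (stay d) t = k.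
Proof.
move=> hN /andP[lt td]; apply/eqP; rewrite eqn_leq nactive_after //= -card_active.
apply/subset_leq_card/fintype.subsetP => m; rewrite finset.in_set inE => sm.
by rewrite /stay nth_default.
Qed.

Lemma nbought_le N pi t : reaches s pi -> instances_given s N -> (nbought pi N t <= k)%N.
Proof.
move=> hr hN; rewrite -card_active; apply/subset_leq_card/fintype.subsetP => m.
rewrite finset.in_set inE => b; rewrite leqNgt; apply/negP => ms.
have [[N0 _] _] := hN.
have := bought_while_active N0 b (le_last_inactive hN ms).
by rewrite (not_bought_before _ hr).
Qed.

Lemma nbought0 N pi t : reaches s pi -> instances_given s N ->
  (t <= last 0%N s)%N -> nbought pi N t = 0%N.
Proof.
move=> hr hN tl; apply/eqP; rewrite cards_eq0; apply/eqP/setP => m.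
by rewrite finset.in_set (not_bought_before _ hr) // finset.in_set0.
Qed.

Definition average_law (d : nat) : R :=
  if (d <= last 0%N s)%N then 0 else
  mean g (fun pi => k%:R^-1 * (nbought pi (stay d) d)%:R).

Let mN N n : @bounded_measurable _ policies R (fun pi => k%:R^-1 * (nbought pi N n)%:R).
Proof. by apply: bounded_measurableZ; exact: bounded_measurable_nbought. Qed.

Lemma average_lawE d n : (0 < n)%N -> (d <= n)%N -> (last 0%N s <= n)%N ->
  average_law d = mean g (fun pi => k%:R^-1 * (nbought pi (stay n) d)%:R).
Proof.
move=> n0 dn ln; rewrite /average_law; case: ifP => [dl|_].
  rewrite -[LHS](mean_cst g 0); apply: ae_eq_mean => //; first exact: bounded_measurable_cst.
  apply: (ae_mono _ g_reaches) => pi hr.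
  by rewrite nbought0 ?mulr0 //; exact: stay_instance.
by congr mean; apply/funext => pi; rewrite (agree_nbought pi (stay_agree dn)).
Qed.

Lemma average_law_purchase : purchase_law s (fun _ : 'I_M -> nat => average_law).
Proof.
split=> //.
- move=> _ d _; rewrite /average_law; case: ifP => [_|/negbT]; first by rewrite lexx ler01.
  rewrite -ltnNge => ld; have hN : instances_given s (stay d) by apply: stay_instance; lia.
  apply/andP; split.
    rewrite -[X in X <= _](mean_cst g 0); apply: mean_le => //; exact: bounded_measurable_cst.
  rewrite -[X in _ <= X](mean_cst g 1); apply: ae_le_mean => //.
    exact: bounded_measurable_cst.
  apply: (ae_mono _ g_reaches) => pi hr; rewrite mulrC ler_pdivrMr // mul1r ler_nat.
  exact: nbought_le.
- move=> _ d _; have [h|h] := leqP (last 0%N s) d.+1.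
    rewrite !(@average_lawE _ d.+1) //; apply: mean_le => // pi.
    rewrite ler_wpM2l ?invr_ge0 // ler_nat; apply/subset_leq_card/fintype.subsetP => m.
    by rewrite !finset.in_set; apply: bought_homo.
  by rewrite /average_law !ifT //; lia.
- by move=> _ d _ dl; rewrite /average_law dl.
Qed.

Let tau := last 0%N s.
Let F i := average_law (tau + i).

Lemma few_active_stay n : (0 < tau + n)%N ->
  (\sum_(t < tau) (nactive (stay (tau + n)) t)%:R) + k%:R * stage_cost 1 B%:R F n
  <= mean g (fun pi => total_cost R B G pi (stay (tau + n))).
Proof.
move=> n0; set N := stay _; have hN : instances_given s N.
  by apply: stay_instance; rewrite ?leq_addr.
have [[N0 _] _] := hN.
have Nn m : (0 < N m <= tau + n)%N.
  rewrite N0 /= /N /stay; case: (ltnP m (size s)) => h; last by rewrite nth_default.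
  rewrite (set_nth_default 0%N) //.
  by apply: leq_trans (nth_state_le_last hs h) _; rewrite leq_addr.
pose f t (pi : policies) : R := k%:R^-1 * (nbought pi N t)%:R.
have Ef i : (i <= n)%N -> F i = mean g (f (tau + i)%N).
  by move=> i_n; rewrite /F (@average_lawE _ (tau + n)) ?leq_add2l ?leq_addr.
have -> : \sum_(t < tau) (nactive N t)%:R + k%:R * stage_cost 1 B%:R F n =
   mean g (fun pi => \sum_(t < tau) (nactive N t)%:R + \sum_(i < n)
     (k%:R * (1 - f (tau + i).+1 pi) + (k%:R * B%:R) * (f (tau + i).+1 pi - f (tau + i)%N pi))).
  rewrite meanD ?mean_cst; last 2 first.
  - exact: bounded_measurable_cst.
  - exact: (@bounded_measurable_stage _ policies R _ _ (fun=> k%:R) (fun=> k%:R * B%:R)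
      (fun (i : 'I_n) => f (tau + i)%N) (fun (i : 'I_n) => f (tau + i).+1)
      (fun i => mN _ _) (fun i => mN _ _)).
  rewrite (@mean_stage _ policies R _ _ _ (fun=> k%:R) (fun=> k%:R * B%:R)
      (fun (i : 'I_n) => f (tau + i)%N) (fun (i : 'I_n) => f (tau + i).+1)
      (fun i => mN _ _) (fun i => mN _ _)); congr (_ + _).
  rewrite /stage_cost mulr_sumr; apply: eq_bigr => i _.
  by rewrite !Ef ?(ltnW (ltn_ord i)) // addnS mul1r mulrDr mulrA.
apply: ae_le_mean.
- apply: bounded_measurableD; first exact: bounded_measurable_cst.
  exact: (@bounded_measurable_stage _ policies R _ _ (fun=> k%:R) (fun=> k%:R * B%:R)
      (fun (i : 'I_n) => f (tau + i)%N) (fun (i : 'I_n) => f (tau + i).+1)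
      (fun i => mN _ _) (fun i => mN _ _)).
- by apply: bounded_measurable_sum => m _; exact: bounded_measurable_agent_cost.
apply: (ae_mono _ g_reaches) => pi hr; rewrite (total_costE R B G pi Nn).
rewrite (@sum_ord_split _ (fun t => \sum_m price R B G (played pi N t) m) (tau + n) tau).
rewrite addKn; apply: lerD.
  rewrite [X in _ <= X](eq_bigl predT); last first.
    by move=> t; rewrite (leq_trans (ltn_ord t) (leq_addr _ _)).
  apply: ler_sum => t _; rewrite sum_price -[X in X <= _]addr0.
  apply: lerD; last exact: spent_ge0.
  have := nactive_le pi t N0; rewrite nbought0 ?addn0 ?ler_nat //.
apply: ler_sum => i _; rewrite -mulrA -mulrDr /f ![k%:R^-1 * _]mulrC.
by apply: day_cost_Ind => //; rewrite nactive_stay // leq_addr ltn_add2l /=.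
Qed.

Lemma few_active_imitation :
  exists Phi, [/\ purchase_law s Phi, buys_when_free s predT Phi &
    forall N, instances_given s N ->
      laws_cost B G predT Phi N <= c * (overall_opt A0 A1 N)%:R].
Proof.
exists (fun _ => average_law); split; first exact: average_law_purchase.
  by move=> N d _ _ [m dm] /(_ m isT); rewrite ltnNge dm.
(* From [k * B < G < M * B] the state [s] is nonempty. *)
have tau0 : (0 < tau)%N.
  case: hs => sM s0 _; move: kBG; rewrite /tau /k; case: (lastP s) s0 sM => [|s' x].
    by move=> _ _; rewrite subn0 ltnNge (ltnW GMB).
  by rewrite last_rcons all_rcons => /andP[].
have minE n : minn (tau + n) B = (minn tau B + minn n (B - tau))%N by lia.
have sum_active_const (f : nat) : (\sum_(m < M | size s <= m) f = k * f)%N.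
  by rewrite sum_nat_const -card_active; congr (_ * _)%N; apply: eq_card => m; rewrite inE.
move=> N hN; rewrite (laws_cost_split _ _ tau).
pose pre : R := (\sum_(m < M) minn (N m) tau)%:R.
have -> : \sum_(t < tau) ((nactive N t)%:R * (1 - average_law t.+1) +
    (nactive N t)%:R * pass_price R B G (nactive N t) *
      (average_law t.+1 - average_law t)) = pre.
  rewrite /pre sum_before natr_sum; apply: eq_bigr => t _.
  by rewrite /average_law !ifT ?(ltnW (ltn_ord t)) // subrr mulr0 addr0 subr0 mulr1.
rewrite (eq_bigr (fun m : 'I_M => stage_cost 1 B%:R F (N m - tau))); last first.
  move=> m _; apply: eq_bigr => i _; rewrite /F addnS /pass_price leqNgt.
  rewrite (_ : (nactive N (tau + i) * B < G)%N) //.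
  apply: leq_ltn_trans kBG; rewrite leq_mul2r nactive_after ?orbT //.
  exact: leq_addr.
rewrite (bigID (fun m : 'I_M => size s <= m)%N) /= [X in _ + (_ + X)]big1 ?addr0; last first.
  move=> m; rewrite -ltnNge => ms.
  by rewrite (_ : (N m - tau = 0)%N) ?stage_cost0 //; apply/eqP; rewrite subn_eq0 le_last_inactive.
(* This is the guarantee of [g] on [stay (tau + n)]. The rent [pre] is the same there as on [N]:
   both have the departures of [s], and all other agents are active through day [tau]. *)
have hC n : pre - c * A0%:R + k%:R * stage_cost 1 B%:R F n
    <= c * (minn G (A1 + k * minn tau B + k * minn n (B - tau)))%:R.
  have n0 : (0 < tau + n)%N by rewrite addn_gt0 tau0.
  have hS := stay_instance n0 (leq_addr n tau).
  have := le_trans (few_active_stay n0) (hg hS).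
  have -> : \sum_(t < tau) (nactive (stay (tau + n)) t)%:R = pre.
    rewrite -natr_sum -sum_before; congr _%:R; apply: eq_bigr => m _.
    case: (ltnP m (size s)) => ms.
      by rewrite /stay (set_nth_default 0%N) //; case: hN => _ ->.
    by rewrite (minn_idPr (last_le_active hS ms)) (minn_idPr (last_le_active hN ms)).
  rewrite /overall_opt (eq_bigr (fun=> minn (tau + n) B)); last first.
    by move=> m ms; rewrite /stay nth_default.
  rewrite sum_active_const minE mulnDr addnA natrD mulrDr; lra.
have := average_cost_le (fun m : 'I_M => N m - tau)%N card_active k0 c0 hC.
rewrite (eq_bigl (fun m : 'I_M => size s <= m)%N) //.
have -> : (A1 + k * minn tau B + \sum_(m in [pred m : 'I_M | (size s <= m)%N])
    minn (N m - tau) (B - tau) = A1 + \sum_(m < M | size s <= m) minn (N m) B)%N.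
  rewrite -addnA; congr (_ + _)%N; rewrite -sum_active_const.
  rewrite [X in (_ + X)%N](eq_bigl (fun m : 'I_M => size s <= m)%N) // -big_split /=.
  apply: eq_bigr => m ms; rewrite -minE subnKC //; exact: last_le_active.
by rewrite /overall_opt natrD mulrDr; lra.
Qed.

End FewActive.
End Imitation.

(** * Imitation: many active agents *)

Section ManyActive.
Variables (R : realType) (M B G : nat) (s : seq nat).
Hypotheses (B0 : (0 < B)%N) (M0 : (0 < M)%N) (BG : (B < G)%N).
Hypothesis hs : is_state M s.
Implicit Types (N : 'I_M -> nat) (m : 'I_M) (t n d : nat).
Local Notation policies := (g_sigma_algebraType (@cylinders M)).
Variables (g : randomized_policy R M).
Hypothesis g_reaches : {ae g, forall pi, reaches s pi}.
Variables (A0 A1 : nat) (c : R).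
Hypotheses (GkB : (G <= (M - size s) * B)%N) (c0 : 0 <= c).
Hypothesis hg : forall N, instances_given s N ->
  mean g (fun pi => total_cost R B G pi N) <= c * (overall_opt B G s A0 A1 N)%:R.

Let G0 : (0 < G)%N. Proof. exact: ltn_trans BG. Qed.
Let G0' : 0 < G%:R :> R. Proof. by rewrite ltr0n. Qed.

(* [a] is the largest number of agents for whom individual passes are cheaper
   than a group pass. *)
Let a := (G.-1 %/ B)%N.
Let k := a.+1.

Let a0 : (0 < a)%N. Proof. by rewrite /a divn_gt0 //; lia. Qed.
Let aBG : (a * B < G)%N.
Proof. have := leq_trunc_div G.-1 B; rewrite -/a; lia. Qed.
Let GkB' : (G <= k * B)%N.
Proof. by have := ltn_ceil G.-1 B0; rewrite -/a -/k; lia. Qed.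
Let kM : (k <= M - size s)%N.
Proof.
rewrite leqNgt; apply/negP; rewrite ltnS => h.
have : ((M - size s) * B <= a * B)%N by rewrite leq_mul2r h orbT.
by move=> h2; have := leq_ltn_trans (leq_trans GkB h2) aBG; rewrite ltnn.
Qed.
Let kG : (0 < k <= G)%N.
Proof.
have : (a * 1 <= a * B)%N by rewrite leq_mul2l B0 orbT.
by rewrite muln1 /k => h; rewrite /= (leq_ltn_trans h aBG).
Qed.

Let subk_ltM : (M - k < M)%N. Proof. by rewrite /k; lia. Qed.
Let mk : 'I_M := Ordinal subk_ltM.

Let size_le : (size s <= M - k)%N. Proof. by move: kM (hs) => + []; lia. Qed.

(* the number of days on which at least [k] agents are active *)
Let tau N := N mk.

Lemma card_last i : (i <= M)%N -> #|[pred m : 'I_M | (M - i <= m)%N]| = i.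
Proof.
move=> iM; rewrite -sum1_card (eq_bigl (fun m : 'I_M => M - i <= m)%N) //.
rewrite -(big_mkord (fun j => M - i <= j)%N (fun=> 1%N)).
rewrite (big_cat_nat (leq0n _) (leq_subr i M)) /= big_nat_cond big1 ?add0n; last by move=> j; lia.
rewrite big_nat_cond (eq_bigl (fun j => (M - i <= j < M) && true)%N); last by move=> j; lia.
by rewrite -big_nat_cond sum_nat_const_nat muln1 subKn.
Qed.

Let kM' : (k <= M)%N. Proof. exact: leq_trans kM (leq_subr _ _). Qed.

Lemma nactive_ge_k N t : instance N -> (t < tau N)%N -> (k <= nactive N t)%N.
Proof.
move=> [_ Nm] tt; rewrite -[X in (X <= _)%N](card_last kM').
apply/subset_leq_card/fintype.subsetP => m; rewrite !inE => km.
exact: leq_trans tt (Nm mk m km).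
Qed.

Lemma nactive_le_a N t : instance N -> (tau N <= t)%N -> (nactive N t <= a)%N.
Proof.
move=> [_ Nm] tt; have aM : (a <= M)%N by exact: leq_trans (leqnSn _) kM'.
rewrite -[X in (_ <= X)%N](card_last aM).
apply/subset_leq_card/fintype.subsetP => m; rewrite !inE => tm.
rewrite leqNgt; apply/negP => h.
have := Nm m mk; rewrite /mk /= => /(_ _).
have -> : (m <= M - k)%N by rewrite /k; lia.
by move=> /(_ isT); rewrite -/mk -/(tau N); lia.
Qed.

Definition fraction_law N d : R := mean g (fun pi => spent_fraction R B G pi N d).

Lemma bounded_measurable_fraction N d :
  @bounded_measurable _ policies R (fun pi => spent_fraction R B G pi N d).
Proof. exact: bounded_measurable_spent_fraction. Qed.

Lemma fraction_law_bounds N d : 0 <= fraction_law N d <= 1.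
Proof.
apply: mean_bounds; first exact: bounded_measurable_fraction.
by move=> pi; exact: spent_fraction_bounds.
Qed.

Lemma fraction_law_homo N d : fraction_law N d <= fraction_law N d.+1.
Proof.
apply: mean_le; try exact: bounded_measurable_fraction.
by move=> pi; exact: spent_fraction_homo.
Qed.

Lemma fraction_law_agree N N' d : agree N N' d -> fraction_law N d = fraction_law N' d.
Proof.
move=> h; congr mean; apply/funext => pi; rewrite /spent_fraction /total_spent.
congr (Num.min _ (_ / _)); apply: eq_bigr => t _.
by rewrite /played (eq_run pi h).
Qed.

Lemma fraction_law0 N d : instances_given s N -> (d <= last 0%N s)%N ->
  fraction_law N d = 0.
Proof.
move=> hN dl; rewrite -(mean_cst g 0); apply: ae_eq_mean.
- exact: bounded_measurable_fraction.
- exact: bounded_measurable_cst.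
apply: (ae_mono _ g_reaches) => pi hr; rewrite /spent_fraction.
rewrite (_ : total_spent R B G pi N d = 0) ?mul0r ?min_r //.
apply: big1 => t _; rewrite /spent big1 // => m bm.
have := not_bought_before m hr hN (leq_trans (ltn_ord t) dl).
by rewrite boughtS bm orbT.
Qed.

Definition early_cost N n : R := \sum_(t < n)
  ((nactive N t)%:R * (1 - fraction_law N t.+1) +
   G%:R * (fraction_law N t.+1 - fraction_law N t)).

Lemma early_cost_le N n : instances_given s N ->
  (forall m, N m <= n)%N -> (forall t, (t < n)%N -> (G <= nactive N t * B)%N) ->
  early_cost N n <= mean g (fun pi => total_cost R B G pi N).
Proof.
move=> [[N0 Nm] Ns] Nn Ge; rewrite /early_cost /fraction_law.
rewrite -(@mean_stage _ policies R _ _ _ (fun t : 'I_n => (nactive N t)%:R) (fun=> G%:R)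
  (fun (t : 'I_n) pi => spent_fraction R B G pi N t)
  (fun (t : 'I_n) pi => spent_fraction R B G pi N t.+1)
  (fun t : 'I_n => bounded_measurable_fraction N t)
  (fun t : 'I_n => bounded_measurable_fraction N t.+1)).
apply: mean_le => [||pi].
- exact: (@bounded_measurable_stage _ policies R _ _ (fun t : 'I_n => (nactive N t)%:R) (fun=> G%:R)
  (fun (t : 'I_n) pi => spent_fraction R B G pi N t)
  (fun (t : 'I_n) pi => spent_fraction R B G pi N t.+1)
  (fun t : 'I_n => bounded_measurable_fraction N t)
  (fun t : 'I_n => bounded_measurable_fraction N t.+1)).
- by apply: bounded_measurable_sum => m _; exact: bounded_measurable_agent_cost.
have Nn' m : (0 < N m <= n)%N by rewrite N0 Nn.
rewrite (total_costE R B G pi Nn'); apply: ler_sum => t _.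
by apply: day_cost_group => //; exact: Ge.
Qed.

(** With [k] agents kept active, [G <= k * B] holds on every day, so [day_cost_group] applies up to
    the end of the instance. *)
Definition keep N j : 'I_M -> nat := fun m => if (M - k <= m)%N then (tau N + j)%N else N m.

Lemma tau_gt0 N : instance N -> (0 < tau N)%N.
Proof. by case=> N0 _; exact: N0. Qed.

Lemma last_le_tau N : instances_given s N -> (last 0%N s <= tau N)%N.
Proof. by move=> hN; exact: (@last_le_active _ _ _ mk hN size_le). Qed.

Lemma keep_instance N j : instances_given s N -> instances_given s (keep N j).
Proof.
move=> hN; have [[N0 Nm] Ns] := hN; split; [split|].
- by move=> m; rewrite /keep; case: ifP => // _; rewrite addn_gt0 tau_gt0.
- move=> m n mn; rewrite /keep; case: (leqP (M - k) m) => h1.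
    by rewrite (leq_trans h1 mn).
  case: ifP => _; last exact: Nm.
  by apply: leq_trans (leq_addr _ _); apply: Nm; exact: ltnW.
- by move=> m ms; rewrite /keep leqNgt (leq_trans ms size_le) /= Ns.
Qed.

Lemma keep_agree N j : instances_given s N -> agree (keep N j) N (tau N).
Proof.
move=> [[_ Nm] _] m; rewrite /keep; case: ifP => // km.
have := Nm mk m km; rewrite -/(tau N) => h; lia.
Qed.

Lemma keep_agree_keep N i j : (i <= j)%N -> agree (keep N i) (keep N j) (tau N + i).
Proof. by move=> ij m; rewrite /keep; case: ifP => // _; lia. Qed.

Lemma nactive_keep N j i : instances_given s N -> (i < j)%N ->
  nactive (keep N j) (tau N + i) = k.
Proof.
move=> [[_ Nm] _] ij; rewrite -[RHS](card_last kM'); apply: eq_card => m.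
rewrite !inE /keep; case: (leqP (M - k) m) => h.
  by rewrite ltn_add2l.
apply/negbTE; rewrite -leqNgt; apply: leq_trans (leq_addr _ _).
by apply: Nm; exact: ltnW.
Qed.

Lemma nactive_keep_early N j t : instances_given s N -> (t < tau N)%N ->
  nactive (keep N j) t = nactive N t.
Proof. by move=> hN tt; apply: agree_nactive (keep_agree j hN) tt. Qed.

Definition early_opt N : nat :=
  (A1 + \sum_(m < M | size s <= m) minn (minn (N m) (tau N)) B)%N.

Definition tail_law N i : R := fraction_law (keep N i) (tau N + i).

Lemma keep_cost N j : instances_given s N ->
  early_cost N (tau N) - c * A0%:R + stage_cost k%:R G%:R (tail_law N) j
  <= c * (minn G (minn G (early_opt N) + k * j))%:R.
Proof.
move=> hN; have hK := keep_instance j hN.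
have KE t : (t <= j)%N -> fraction_law (keep N j) (tau N + t) = tail_law N t.
  by move=> tj; rewrite /tail_law (fraction_law_agree (keep_agree_keep N tj)).
have EK : early_cost (keep N j) (tau N + j) =
    early_cost N (tau N) + stage_cost k%:R G%:R (tail_law N) j.
  rewrite /early_cost (@sum_ord_split R (fun t => (nactive (keep N j) t)%:R *
    (1 - fraction_law (keep N j) t.+1) +
    G%:R * (fraction_law (keep N j) t.+1 - fraction_law (keep N j) t)) _ (tau N)).
  rewrite addKn; apply: (congr2 +%R); last first.
    apply: eq_bigr => i _; rewrite (nactive_keep hN) // -addnS.
    by rewrite (KE _ (ltn_ord i)) (KE _ (ltnW (ltn_ord i))).
  rewrite (eq_bigl predT); last by move=> t; rewrite (leq_trans (ltn_ord t) (leq_addr _ _)).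
  apply: eq_bigr => t _; rewrite nactive_keep_early //.
  rewrite !(@fraction_law_agree (keep N j) N) //.
    by apply: agree_le (keep_agree j hN); exact: ltnW.
  by apply: agree_le (keep_agree j hN); exact: ltn_ord.
have Kn m : (keep N j m <= tau N + j)%N.
  rewrite /keep; case: (leqP (M - k) m) => // h; apply: leq_trans (leq_addr _ _).
  by case: hN => [[_ Nm] _]; apply: Nm; exact: ltnW.
have Kact t : (t < tau N + j)%N -> (G <= nactive (keep N j) t * B)%N.
  move=> tj; apply: (leq_trans GkB'); rewrite leq_mul2r.
  apply/orP; right; apply: nactive_ge_k; first by case: hK.
  by rewrite /tau /keep leqnn.
have := le_trans (early_cost_le hK Kn Kact) (hg hK); rewrite EK.
have : c * (overall_opt B G s A0 A1 (keep N j))%:R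
    <= c * (A0%:R + (minn G (minn G (early_opt N) + k * j))%:R).
  rewrite -natrD ler_wpM2l // ler_nat /overall_opt leq_add2l.
  have : (\sum_(m < M | size s <= m) minn (keep N j m) B
      <= \sum_(m < M | size s <= m) minn (minn (N m) (tau N)) B + k * j)%N.
    have -> : (k * j = \sum_(m < M | (size s <= m)%N && (M - k <= m)%N) j)%N.
      rewrite sum_nat_const -{1}(card_last kM'); congr (_ * _)%N; apply: eq_card => m.
      rewrite !inE /in_mem /=; case: (leqP (M - k) m) => h; rewrite ?andbF //.
      by rewrite (leq_trans size_le h).
    rewrite big_mkcondr -big_split /=; apply: leq_sum => m _.
    rewrite /keep; case: (leqP (M - k) m) => h; case: hN => [[_ Nm] _].
      by have := Nm mk m h; rewrite -/(tau N); lia.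
    by have := Nm m mk (ltnW h); rewrite -/(tau N); lia.
  by rewrite /early_opt; lia.
by rewrite mulrDr; lra.
Qed.

Let x N := minn G (early_opt N).
Let X N := early_cost N (tau N) - c * A0%:R.
(** The same number is the potential of [budget_needed] on the instances [keep N j] and the starting
    value of [catch_up] on [N]. *)
Let E N := (c * (x N)%:R - X N) / G%:R + fraction_law N (tau N) + c - 1.

Lemma tail_law0 N : instances_given s N -> tail_law N 0 = fraction_law N (tau N).
Proof.
by move=> hN; rewrite /tail_law addn0; apply: fraction_law_agree; exact: keep_agree.
Qed.

Lemma tail_law_homo N i : tail_law N i <= tail_law N i.+1.
Proof.
rewrite /tail_law (fraction_law_agree (keep_agree_keep N (leqnSn i))) addnS.
exact: fraction_law_homo.
Qed.

Lemma x_le_G N : (x N <= G)%N. Proof. exact: geq_minl. Qed.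

Lemma decay_le_E N : instances_given s N -> c * decay R k G (G - x N) <= E N.
Proof.
move=> hN; rewrite /E -(tail_law0 hN); apply: budget_needed => //.
- by rewrite subnKC // x_le_G.
- by move=> i; exact: fraction_law_bounds.
- by move=> i; exact: tail_law_homo.
- by move=> j; exact: keep_cost.
Qed.

Lemma X_le N : instances_given s N -> 0 <= c * (x N)%:R - X N.
Proof.
move=> hN; have := keep_cost 0 hN; rewrite stage_cost0 addr0 muln0 addn0 subr_ge0.
by rewrite minnA minnn.
Qed.

(** Unless the benchmark is already saturated, the last [k] agents have contributed [tau N] each to
    it; since [G <= k * B], this happens only before day [B]. *)
Lemma slack_cases N : instances_given s N ->
  x N = G \/ [/\ (tau N < B)%N & (k * tau N <= x N)%N].
Proof.
move=> hN; have [h|h] := leqP G (early_opt N); first by left; apply/minn_idPl.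
right; have hk : (k * minn (tau N) B <= early_opt N)%N.
  rewrite /early_opt -{1}(card_last kM') -sum_nat_const.
  apply: leq_trans (leq_addl _ _); rewrite big_mkcond [X in (_ <= X)%N]big_mkcond /=.
  apply: leq_sum => m _; rewrite inE; case: ifP => // km.
  rewrite (leq_trans size_le km).
  by case: hN => [[_ Nm] _]; have := Nm mk m km; rewrite -/(tau N); lia.
have tB : (tau N < B)%N.
  rewrite ltnNge; apply/negP => Bt; move: hk; rewrite (minn_idPr Bt); have := GkB'; lia.
split=> //; rewrite /x (minn_idPr (ltnW h)); move: hk.
by rewrite (minn_idPl (ltnW tB)).
Qed.

Lemma E_day N : instances_given s N -> c * (1 - 1 / B%:R) ^+ (B - tau N) <= E N.
Proof.
move=> hN; apply: le_trans (decay_le_E hN); rewrite ler_wpM2l //.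
have t0 : (0 < tau N)%N by apply: tau_gt0; case: hN.
have [->|[tB kt]] := slack_cases hN.
  rewrite subnn /decay div0n mod0n expr0 mul0r subr0 mulr1.
  by apply: exprn_ile1; case/andP: (@rate_bounds R 1 B B0 B0).
apply: rate_pow_le_decay => //.
  by have := x_le_G N; lia.
Qed.

Lemma E_group N i o : instances_given s N -> (o <= a)%N -> (x N + a * i + o = G)%N ->
  c * (1 - 1 / B%:R) ^+ i * (1 - o%:R / (a * B)%:R) <= E N.
Proof.
move=> hN oa xio; apply: le_trans (decay_le_E hN); rewrite -mulrA ler_wpM2l //.
have [xG|[tB kt]] := slack_cases hN.
  have io : (a * i = 0)%N /\ o = 0%N by split; lia.
  have i0 : i = 0%N by case: io; case: (i) => // j; rewrite mulnS; lia.
  by rewrite xG subnn (proj2 io) i0 /decay div0n mod0n !mul0r !expr0.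
have t0 : (0 < tau N)%N by apply: tau_gt0; case: hN.
have -> : (G - x N = a * i + o)%N by lia.
have aB : (0 < a <= a * B)%N by rewrite a0 leq_pmulr.
(* The price is raised from [a * B] to [G - 1], then one agent and one unit of price are added
   together to reach [k] and [G]. *)
apply: (@le_trans _ _ (decay R a (a * B) (a * i + o))).
  rewrite decayE // natrM.
  have -> : a%:R / (a%:R * B%:R) = 1 / B%:R :> R.
    by field; rewrite !pnatr_eq0 -!lt0n a0 B0.
  by [].
apply: (@le_trans _ _ (decay R a G.-1 (a * i + o))).
  by apply: decay_le_price => //; have := aBG; lia.
apply: decay_pred_price => //.
have : (a * 2 <= a * B)%N by rewrite leq_mul2l; apply/orP; right; lia.
by have := aBG; have := a0; lia.
Qed.

Definition mixed_law N d : R :=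
  if (d <= last 0%N s)%N then 0 else
  if (d <= tau N)%N then fraction_law N d else
  catch_up B c (E N) (fraction_law N (tau N)) (d - tau N).

Let F N := catch_up B c (E N) (fraction_law N (tau N)).

Lemma mixed_law_late N i : instances_given s N -> mixed_law N (tau N + i) = F N i.
Proof.
move=> hN; have lt := last_le_tau hN; rewrite /mixed_law; case: i => [|i].
  rewrite addn0 leqnn; case: ifP => // h.
  by rewrite /F /= fraction_law0.
by rewrite !ifF ?addKn //; lia.
Qed.

Lemma mixed_law_early N d : instances_given s N -> (d <= tau N)%N ->
  mixed_law N d = fraction_law N d.
Proof.
move=> hN dt; rewrite /mixed_law dt; case: ifP => // h.
by rewrite fraction_law0.
Qed.

Let F_bounds N i : instances_given s N -> 0 <= F N i <= 1.
Proof.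
move=> hN; have f01 := fraction_law_bounds N (tau N).
have /andP[h1 h2] := catch_up_bounds B0 c0 f01 (X_le hN)
  (E_day hN) i.
by rewrite h2 andbT (le_trans _ h1) //; case/andP: f01.
Qed.

Let F_homo N i : instances_given s N -> F N i <= F N i.+1.
Proof.
move=> hN; exact: (catch_up_homo B0 c0
  (fraction_law_bounds N (tau N)) (X_le hN) (E_day hN) i).
Qed.

Lemma mixed_law_purchase : purchase_law s mixed_law.
Proof.
split.
- move=> N N' d NN'; rewrite /mixed_law; case: ifP => // _.
  have tt := NN' mk; rewrite -/(tau N) -/(tau N') in tt.
  have [h|h] := leqP d (tau N).
    have h' : (d <= tau N')%N by lia.
    by rewrite h' (fraction_law_agree NN').
  (* Past day [tau N], agreement up to [d] reveals the departure of agent [mk], and [E] depends only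
     on what happened until then. *)
  have tE : tau N = tau N' by lia.
  rewrite -tE leqNgt h /=.
  have NNt : agree N N' (tau N) by apply: agree_le NN'; exact: ltnW.
  have fE t : (t <= tau N)%N -> fraction_law N t = fraction_law N' t.
    by move=> tt'; apply: fraction_law_agree; apply: agree_le NNt.
  have xE : x N = x N'.
    rewrite /x /early_opt -tE; congr (minn _ (_ + _)); apply: eq_bigr => m _.
    by rewrite NNt.
  have XE : X N = X N'.
    rewrite /X /early_cost -tE; apply: (congr2 (fun y z => y - z)) => //.
    apply: eq_bigr => t _.
    by rewrite (agree_nactive NNt (ltn_ord t)) (fE _ (ltn_ord t)) (fE _ (ltnW (ltn_ord t))).
  by rewrite /E XE xE -tE !fE.
- move=> N d hN; rewrite /mixed_law; case: ifP => _; first by rewrite lexx ler01.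
  case: ifP => _; [exact: fraction_law_bounds | exact: F_bounds].
- move=> N d hN; have [h|h] := ltnP d (tau N).
    rewrite !mixed_law_early //; [exact: fraction_law_homo | exact: ltnW].
  rewrite -(subnKC h) -addnS !mixed_law_late //; exact: F_homo.
- by move=> N d hN dl; rewrite /mixed_law dl.
Qed.

Lemma many_active_imitation :
  exists Phi, [/\ purchase_law s Phi, buys_when_free s predT Phi &
    forall N, instances_given s N ->
      laws_cost B G predT Phi N <= c * (overall_opt B G s A0 A1 N)%:R].
Proof.
exists mixed_law; split; first exact: mixed_law_purchase.
  by move=> N d _ _ [m dm] /(_ m isT); rewrite ltnNge dm.
move=> N hN; have [iN _] := hN; have [N0 Nm] := iN.
rewrite (laws_cost_split _ _ _ _ (tau N)).
have -> : \sum_(t < tau N) ((nactive N t)%:R * (1 - mixed_law N t.+1) +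
    (nactive N t)%:R * pass_price R B G (nactive N t) *
      (mixed_law N t.+1 - mixed_law N t)) = early_cost N (tau N).
  apply: eq_bigr => t _; rewrite !mixed_law_early // ?(ltnW (ltn_ord t)) //.
  congr (_ + _ * _); rewrite /pass_price.
  have kn := nactive_ge_k iN (ltn_ord t).
  have -> : (G <= nactive N t * B)%N.
    by apply: (leq_trans GkB'); rewrite leq_mul2r kn orbT.
  rewrite mulrC divfK // pnatr_eq0 -lt0n; exact: leq_trans kn.
rewrite (eq_bigr (fun m : 'I_M => stage_cost 1 B%:R (F N) (N m - tau N))); last first.
  move=> m _; apply: eq_bigr => i _; rewrite -addnS !mixed_law_late // /pass_price leqNgt.
  rewrite (_ : (nactive N (tau N + i) * B < G)%N) //.
  apply: leq_ltn_trans aBG; rewrite leq_mul2r nactive_le_a ?orbT //; exact: leq_addr.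
rewrite (bigID (fun m : 'I_M => M - a <= m)%N) /= [X in _ + (_ + X)]big1 ?addr0; last first.
  move=> m; rewrite -ltnNge => ms.
  rewrite (_ : (N m - tau N = 0)%N) ?stage_cost0 //; apply/eqP; rewrite subn_eq0.
  by apply: Nm => /=; rewrite /k; lia.
have hC n : X N + a%:R * stage_cost 1 B%:R (F N) n
    <= c * (minn G (x N + a * minn n (B - tau N)))%:R.
  apply: (catch_up_cost a0 B0 (ltnW aBG) (x_le_G N) c0
    (X_le hN) (E_day hN)) => i o; exact: E_group.
have aM : (a <= M)%N by exact: leq_trans (leqnSn _) kM'.
have := average_cost_le (fun m : 'I_M => N m - tau N)%N (card_last aM) a0 c0 hC.
rewrite (eq_bigl (fun m : 'I_M => M - a <= m)%N) //.
have : c * (minn G (x N + \sum_(m in [pred m : 'I_M | (M - a <= m)%N])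
     minn (N m - tau N) (B - tau N)))%:R + c * A0%:R <= c * (overall_opt B G s A0 A1 N)%:R.
  rewrite -mulrDr -natrD ler_wpM2l // ler_nat /overall_opt addnC leq_add2l.
  (* The contribution of each agent to the benchmark is split at day [tau N]. *)
  have : (\sum_(m < M | size s <= m) minn (minn (N m) (tau N)) B +
     \sum_(m in [pred m : 'I_M | (M - a <= m)%N]) minn (N m - tau N) (B - tau N)
     <= \sum_(m < M | size s <= m) minn (N m) B)%N.
    rewrite [X in (_ + X)%N](eq_bigl (fun m : 'I_M => (size s <= m) && (M - a <= m))%N); last first.
      move=> m; rewrite /in_mem /=; case: (leqP (M - a) m) => h; rewrite ?andbF ?andbT //.
      by apply/esym; apply: leq_trans h; apply: leq_trans size_le _; rewrite leq_sub2l.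
    rewrite big_mkcondr -big_split /=; apply: leq_sum => m _.
    by case: ifP => _; lia.
  by rewrite /x /early_opt; lia.
rewrite /X; lra.
Qed.

End ManyActive.

(** * The three competitive ratios *)

Section Benchmarks.
Variables (R : realType) (M B G : nat) (s : seq nat).
Hypotheses (M0 : (0 < M)%N) (B0 : (0 < B)%N) (BG : (B < G)%N) (GMB : (G < M * B)%N).
Hypothesis hs : is_state M s.
Implicit Types (N : 'I_M -> nat) (m : 'I_M).

Let G0 : (0 < G)%N. Proof. exact: ltn_trans BG. Qed.

Lemma overall_CR_minimized (opt : ('I_M -> nat) -> R) (A0 A1 : nat) :
  (forall N, instances_given s N -> opt N = (overall_opt B G s A0 A1 N)%:R) ->
  minimized_by_symmetric s (CR (@total_cost R M B G) opt s).
Proof.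
move=> optE; apply: (@CR_minimized R M B G s G0 B0 M0 hs predT) => //.
- move=> N hN; rewrite optE // ltr0n /overall_opt.
  have [sM _ _] := hs; have [[N0 _] _] := hN.
  rewrite addn_gt0; apply/orP; right; rewrite leq_min G0 addn_gt0; apply/orP; right.
  rewrite (bigD1 (Ordinal sM)) //= addn_gt0 leq_min N0 B0 //.
- exists (A0 + G)%:R => N hN; rewrite optE // ler_nat leq_add2l; exact: geq_minl.
- move=> g c c0 hr hg.
  have hg' N : instances_given s N ->
      mean g (fun pi => total_cost R B G pi N) <= c * (overall_opt B G s A0 A1 N)%:R.
    by move=> hN; rewrite -optE //; exact: hg.
  have [Phi [h1 h2 h3]] : exists Phi : ('I_M -> nat) -> nat -> R,
      [/\ purchase_law s Phi, buys_when_free s predT Phi & forall N, instances_given s N ->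
      laws_cost B G predT Phi N <= c * (overall_opt B G s A0 A1 N)%:R].
    have [GkB|kBG] := leqP G ((M - size s) * B).
      by apply: many_active_imitation => //; [exact: hr | exact: hg'].
    by apply: few_active_imitation => //; [exact: hr | exact: hg'].
  by exists Phi; split=> // N hN; rewrite optE //; exact: h3.
Qed.

Lemma OPT_OVE N : instances_given s N -> OPT_OV R B G N =
  (overall_opt B G s 0 (\sum_(m < M | (m < size s)%N) minn (nth 0%N s m) B) N)%:R.
Proof.
move=> [_ Ns]; rewrite /OPT_OV /overall_opt add0n; congr (minn _ _)%:R.
rewrite (bigID (fun m : 'I_M => (m < size s)%N)) /=; congr (_ + _)%N.
  by apply: eq_bigr => m ms; rewrite minnC Ns.
by apply: eq_big => m; [rewrite -leqNgt | rewrite minnC].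
Qed.

Lemma OPT_SDE N : instances_given s N -> OPT_SD R B G s N =
  (overall_opt B G s (\sum_(m < M | (m < size s)%N) nth 0%N s m) 0 N)%:R.
Proof.
move=> [_ Ns]; rewrite /OPT_SD /overall_opt add0n; congr (_ + _)%:R.
by apply: eq_bigr => m; exact: Ns.
Qed.

Lemma share_bounds j : 0 < share R M B G j <= B%:R.
Proof.
have B0' : 0 < B%:R :> R by rewrite ltr0n.
rewrite /share; case: ifP => jM; last by rewrite B0' lexx.
rewrite lt_min B0' divr_gt0 ?ltr0n ?subn_gt0 //=.
by rewrite ge_min lexx orbT.
Qed.

Lemma OPT_IND_bounds m N : (0 < N m)%N -> 0 < OPT_IND R B G m N <= B%:R.
Proof.
move=> N0; have /andP[h1 h2] := share_bounds (ell_star R B G N).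
rewrite /OPT_IND; case: ifP => [h|_]; last by rewrite h1 h2.
by rewrite ltr0n N0 (le_trans h h2).
Qed.

Lemma individual_CR_minimized m : minimized_by_symmetric s (@CR_IND R M B G m s).
Proof.
apply: (@CR_minimized R M B G s G0 B0 M0 hs (pred1 m)) => //.
- by move=> pi N; rewrite big_pred1_eq.
- by move=> N [[N0 _] _]; case/andP: (OPT_IND_bounds (N0 m)).
- by exists B%:R => N [[N0 _] _]; case/andP: (OPT_IND_bounds (N0 m)).
- by move=> g c c0 hr hg; apply: agent_imitation => //; [exact: hr | exact: hg].
Qed.

End Benchmarks.

Theorem lemma9 (R : realType) (M B G : nat) (hM : (0 < M)%N) (hB : (0 < B)%N)
    (hBG : (B < G)%N) (hGMB : (G < M * B)%N)
    (s : seq nat) (hs : is_state M s) :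
  minimized_by_symmetric s (@CR_OV R M B G s) /\
  minimized_by_symmetric s (@CR_SD R M B G s) /\
  (forall m : 'I_M, minimized_by_symmetric s (@CR_IND R M B G m s)).
Proof.
split; [|split=> [|m]].
- by apply: (overall_CR_minimized hM hB hBG hGMB hs) => N; exact: OPT_OVE.
- by apply: (overall_CR_minimized hM hB hBG hGMB hs) => N; exact: OPT_SDE.
- exact: individual_CR_minimized.
Qed.
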